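(* Let $\lambda>0$, $0<\phi<\pi$ and let $x\in\mathbb C$ with $\operatorname{Im}x>0$. Then $$\lim_{n\to\infty}\frac{P_n^{( * )}(x,\lambda,\phi)}{P_n^{(\lambda)}(x;\phi)}=2\sin\phi\int_0^{e^{-i\phi}}(1-ue^{i\phi})^{\lambda-ix-1}(1-ue^{-i\phi})^{\lambda+ix-1}\,du .$$
   Context: The Meixner--Pollaczek polynomials are $$P_n^{(\lambda)}(x;\phi)=e^{in\phi}\sum_{k=0}^n\frac{(\lambda+ix)_k(\lambda-ix)_{n-k}}{k!\,(n-k)!}e^{-2ik\phi},$$ with $(\alpha)_0=1$, $(\alpha)_k=\alpha(\alpha+1)\cdots(\alpha+k-1)$. The numerator polynomials $P_n^{( * )}(x,\lambda,\phi)$ are defined by $P_0^{( * )}=0$, $P_1^{( * )}=2\sin\phi$ and, for $n\ge1$, the recurrence $2[x\sin\phi+(n+\lambda)\cos\phi]y_n=(n+1)y_{n+1}+(n+2\lambda-1)y_{n-1}$ (also satisfied by $y_n=P_n^{(\lambda)}(x;\phi)$). Powers are principal branches, and the integral is taken along the straight segment from $0$ to $e^{-i\phi}$. *)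

(* Defs.v *)
From Stdlib Require Import Arith Reals Lra.
From Coquelicot Require Import Coquelicot.

Open Scope R_scope.
Open Scope C_scope.

(** * Principal complex exponential, logarithm and powers *)

Definition Cexp (z : C) : C :=
  (exp (Re z) * cos (Im z), exp (Re z) * sin (Im z))%R.

(** Principal argument, with values in (-PI, PI] for [z <> 0]; the negative
    real axis is sent to [PI]. *)
Definition Carg (z : C) : R :=
  if Rle_dec 0 (Im z) then acos (Re z / Cmod z) else (- acos (Re z / Cmod z))%R.

Definition Clog (z : C) : C := (ln (Cmod z), Carg z).

(** Principal branch of [z ^ a]; only meaningful for [z <> 0]. *)
Definition Cpower (z a : C) : C := Cexp (a * Clog z).

(** * Meixner--Pollaczek polynomials *)

(** [Cpoch a k] is a (a + 1) ... (a + k - 1). *)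
Fixpoint Cpoch (a : C) (k : nat) : C :=
  match k with
  | O => 1
  | S j => Cpoch a j * (a + INR j)
  end.

Definition MP (lambda phi : R) (x : C) (n : nat) : C :=
  Cexp (Ci * INR n * phi) *
  sum_n (fun k : nat =>
           Cpoch (lambda + Ci * x) k * Cpoch (lambda - Ci * x) (n - k)
           / (INR (fact k) * INR (fact (n - k)))
           * Cexp (- (2 * Ci * INR k * phi))) n.

(** Numerator polynomials: the three-term recurrence solved for its term of
    highest index. *)
Fixpoint MPnum (lambda phi : R) (x : C) (n : nat) : C :=
  match n with
  | O => 0
  | S m =>
      match m with
      | O => 2 * sin phi
      | S p =>
          (2 * (x * sin phi + (INR m + lambda) * cos phi)
             * MPnum lambda phi x m
           - (INR m + 2 * lambda - 1) * MPnum lambda phi x p)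
          / (INR m + 1)
      end
  end.

Lemma MPnum_rec (lambda phi : R) (x : C) (n : nat) (hn : (1 <= n)%nat) :
  2 * (x * sin phi + (INR n + lambda) * cos phi) * MPnum lambda phi x n
  = (INR n + 1) * MPnum lambda phi x (n + 1)
    + (INR n + 2 * lambda - 1) * MPnum lambda phi x (n - 1).
Proof.
  destruct n as [|p]; [inversion hn|].
  replace (S p + 1)%nat with (S (S p)) by (rewrite Nat.add_comm; reflexivity).
  replace (S p - 1)%nat with p by (simpl; symmetry; apply Nat.sub_0_r).
  change (MPnum lambda phi x (S (S p))) with
    ((2 * (x * sin phi + (INR (S p) + lambda) * cos phi)
        * MPnum lambda phi x (S p)
      - (INR (S p) + 2 * lambda - 1) * MPnum lambda phi x p)
     / (INR (S p) + 1)).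
  field.
  intro H; apply (f_equal fst) in H; cbn [fst Cplus RtoC] in H.
  pose proof (pos_INR (S p)); lra.
Qed.

(** * Integral along a straight segment *)

(** [v] is the integral of [f] along the segment from [a] to [b], as a Riemann
    integral improper at the endpoint [b] (where [f] may be singular). *)
Definition is_segment_integral (f : C -> C) (a b v : C) : Prop :=
  is_RInt_gen (V := C_R_NormedModule)
    (fun t : R => f (a + t * (b - a)) * (b - a)) (at_point 0) (at_left 1) v.

(* Main.v *)
Require Import Defs.
From Stdlib Require Import Arith Reals Lra Lia.
From Coquelicot Require Import Coquelicot.
Open Scope R_scope.
Open Scope C_scope.

(** With w_n = n!/(2 lambda)_n, both P_n and Q_n = P*_n / (2 sin phi) solve a
    symmetric (Jacobi) form of the recurrence.  Put a = e^{-i phi} and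
    g_n = int_0^a u^n (1-u/a)^{lambda-ix-1} (1-ua)^{lambda+ix-1} du.  Integrating
    the derivative of u^n (1-u/a)^{lambda-ix} (1-ua)^{lambda+ix} from 0 to a shows
    that g_n / w_n solves the same recurrence, and the boundary term at n = 0
    gives g_n / w_n = J P_n - Q_n with J = g_0.  A Beta integral bounds g_n, so
    y_n = J P_n - Q_n is the square summable solution; then the Weyl disks, which
    contain Q_n / P_n and J, shrink to a point by Carleman's criterion
    (the off-diagonal coefficients grow linearly).  No asymptotics of P_n is
    needed. *)

(** * Weyl disks and Carleman's criterion for Jacobi recurrences *)

(** Put b = lambda + Im x. The exponent lambda - ix - 1 has real part b - 1, possibly negative, so
    g_n is improper at a. Everything is therefore done on truncated segments from 0 to T a with T <
    1, up to errors bounded by a constant times (1-T)^b. T tends to 1 with n fixed, so these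
    constants may depend on n. Square summability of y is not estimated term by term. With c_n =
    (n+1) w_n the off-diagonal coefficient, w_n has order n^(1 - 2 lambda) and g_n = O(n^(-b)), so
    c_n y_n y_{n+1} = O(n^(-2 Im x)); only its boundedness is established, and Green's formula turns
    that into a bound on the mass of y. The hypothesis Im x > 0 acts at two places: the spectral
    parameter z = 2 x sin phi gets a positive imaginary part, so that the flux of P_n grows with its
    mass, and b exceeds lambda, so that c_n y_n y_{n+1} stays bounded. *)

Definition jacobi (c w r : nat -> R) (z : C) (u : nat -> C) (n : nat) : Prop :=
  c (S n) * u (S (S n)) + c n * u n = (z + r (S n)) * w (S n) * u (S n).

(* Im (u_{n+1} conj(u_n)) weighted by the off-diagonal coefficient; its increments are
   Im z times the mass (Green's formula). *)
Definition flux (c : nat -> R) (u : nat -> C) (n : nat) : R :=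
  (c n * (Im (u (S n)) * Re (u n) - Re (u (S n)) * Im (u n)))%R.

Definition wmass (w : nat -> R) (u : nat -> C) (n : nat) : R :=
  (w n * Cmod (u n) ^ 2)%R.

(** Multiply the recurrence by the conjugate of [u (S n)] and take imaginary parts: [r] is real, so
    only [Im z] survives on the right. *)
Lemma flux_step (c w r : nat -> R) (z : C) (u : nat -> C) (n : nat) :
  jacobi c w r z u n ->
  flux c u (S n) = (flux c u n + Im z * wmass w u (S n))%R.
Proof.
  unfold jacobi, flux, wmass. rewrite Cmod2_alt.
  generalize (c (S n)) (c n) (r (S n)) (w (S n)); intros c1 c0 r1 w1.
  destruct (u (S (S n))) as [a2 b2], (u (S n)) as [a1 b1], (u n) as [a0 b0], z as [zr zi].
  simpl. unfold Cmult, Cplus, RtoC; simpl. intro E.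
  pose proof (f_equal fst E) as E1; pose proof (f_equal snd E) as E2; simpl in E1, E2.
  apply (f_equal (Rmult b1)) in E1. apply (f_equal (Rmult a1)) in E2. lra.
Qed.

Lemma flux_sum (c w r : nat -> R) (z : C) (u : nat -> C) (n : nat) :
  (forall k, jacobi c w r z u k) ->
  flux c u n = (flux c u 0 + Im z * (sum_n (wmass w u) n - wmass w u 0))%R.
Proof.
  intro H; induction n as [|n IH].
  - rewrite sum_O; ring.
  - rewrite (flux_step c w r z u n (H n)), IH, sum_Sn. change plus with Rplus. simpl. ring.
Qed.

(** Discrete Wronskian: because the recurrence is symmetric, multiplying each equation by the other
    solution makes the right-hand sides cancel. *)
Lemma casorati_const (c w r : nat -> R) (z : C) (u v : nat -> C) (n : nat) :
  (forall k, jacobi c w r z u k) -> (forall k, jacobi c w r z v k) ->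
  c n * (u n * v (S n) - u (S n) * v n) = c O * (u O * v 1%nat - u 1%nat * v O).
Proof.
  intros Hu Hv; induction n as [|n IH]; [reflexivity|].
  rewrite <- IH. specialize (Hu n); specialize (Hv n); unfold jacobi in *.
  transitivity (u (S n) * (c (S n) * v (S (S n)) + c n * v n)
                - (c (S n) * u (S (S n)) + c n * u n) * v (S n)
                + c n * (u n * v (S n) - u (S n) * v n)); [ring|].
  rewrite Hu, Hv. ring.
Qed.

Lemma Im_mul_conj_le (a b : C) : (Rabs (Im a * Re b - Re a * Im b) <= Cmod a * Cmod b)%R.
Proof.
  replace (Im a * Re b - Re a * Im b)%R with (Im (a * Cconj b)).
  2:{ destruct a, b; simpl; ring. }
  rewrite <- (Cmod_conj b), <- Cmod_mult.
  eapply Rle_trans; [|apply Rmax_Cmod]. apply Rmax_r.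
Qed.

(** Telescoping of ln (1 + 1/m) <= 1/m. This is the divergence that feeds Carleman's criterion. *)
Lemma harmonic_shift_ge (M : R) (n : nat) : (0 < M)%R ->
  (ln (INR n + 1 + M) - ln M <= sum_n (fun k => / (INR k + M)) n)%R.
Proof.
  intro HM.
  assert (step : forall m, (0 < m -> ln (m + 1) - ln m <= / m)%R).
  { intros m Hm. rewrite <- ln_div by lra.
    rewrite <- (ln_exp (/ m)). apply ln_le.
    - apply Rdiv_lt_0_compat; lra.
    - replace ((m + 1) / m)%R with (1 + / m)%R by (field; lra). apply exp_ineq1_le. }
  induction n as [|n IH].
  - rewrite sum_O. simpl. replace (0 + 1 + M)%R with (M + 1)%R by ring.
    rewrite Rplus_0_l. apply step, HM.
  - rewrite sum_Sn. change plus with Rplus; cbv beta.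
    pose proof (pos_INR (S n)).
    specialize (step (INR (S n) + M)%R ltac:(lra)). rewrite S_INR in *.
    replace (INR n + 1 + 1 + M)%R with (INR n + 1 + M + 1)%R by ring. lra.
Qed.

(* p and q are the solutions of first and second kind; the hypothesis [y_bound] makes
   y = J p - q square summable. *)
Section LimitPoint.
Variables (c w r : nat -> R) (z : C) (p q : nat -> C) (J : C) (M K : R).
Hypotheses (w_gt0 : forall n, (0 < w n)%R) (c_gt0 : forall n, (0 < c n)%R).
Hypothesis c_le : forall n, (c n ^ 2 <= (INR n + M) ^ 2 * (w n * w (S n)))%R.
Hypothesis M_gt0 : (0 < M)%R.
Hypothesis z_gt0 : (0 < Im z)%R.
Hypotheses (p_rec : forall n, jacobi c w r z p n) (q_rec : forall n, jacobi c w r z q n).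
Hypotheses (p_0 : p O = 1) (q_0 : q O = 0).
Hypothesis p_1 : c O * p 1%nat = (z + r O) * w O.
Hypothesis q_1 : c O * q 1%nat = 1.
Let y n := J * p n - q n.
Hypothesis y_bound : forall n, (c n * (Cmod (y (S n)) * Cmod (y n)) <= K)%R.

Lemma second_rec (n : nat) : jacobi c w r z y n.
Proof.
  specialize (p_rec n); specialize (q_rec n); unfold jacobi, y in *.
  transitivity (J * (c (S n) * p (S (S n)) + c n * p n)
                - (c (S n) * q (S (S n)) + c n * q n)); [ring|].
  rewrite p_rec, q_rec; ring.
Qed.

Lemma wmass_ge0 (u : nat -> C) (n : nat) : (0 <= wmass w u n)%R.
Proof.
  unfold wmass. apply Rmult_le_pos; [apply Rlt_le, w_gt0|apply pow2_ge_0].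
Qed.

(** [jacobi] only covers the equations of index at least 1; [p_1] is the equation of index 0 with
    p_{-1} = 0, so no initial flux is added to the mass. *)
Lemma flux_sum_mass (n : nat) : flux c p n = (Im z * sum_n (wmass w p) n)%R.
Proof.
  rewrite (flux_sum c w r z p n p_rec).
  enough (E : flux c p 0 = (Im z * wmass w p 0)%R) by (rewrite E; ring).
  unfold flux, wmass. rewrite p_0, Cmod_1.
  pose proof (f_equal Im p_1) as E. simpl in E. unfold Re, Im in *. simpl. lra.
Qed.

Lemma flux_y_le (n : nat) : (Rabs (flux c y n) <= K)%R.
Proof.
  unfold flux. rewrite Rabs_mult, (Rabs_right (c n)) by (apply Rle_ge, Rlt_le, c_gt0).
  eapply Rle_trans; [|apply y_bound].
  apply Rmult_le_compat_l; [apply Rlt_le, c_gt0|apply Im_mul_conj_le].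
Qed.

Lemma mass_p_gt0 (n : nat) : (0 < sum_n (wmass w p) n)%R.
Proof.
  induction n as [|n IH].
  - rewrite sum_O. unfold wmass. rewrite p_0, Cmod_1. specialize (w_gt0 O). lra.
  - rewrite sum_Sn. change plus with Rplus; simpl. pose proof (wmass_ge0 p (S n)). lra.
Qed.

(** Both terms of the flux contain a component of [p n], and the flux is positive. *)
Lemma jacobi_neq0 (n : nat) : p n <> 0.
Proof.
  intro E. pose proof (flux_sum_mass n) as F. unfold flux in F. rewrite E in F. simpl in F.
  pose proof (mass_p_gt0 n) as G. pose proof (Rmult_lt_0_compat _ _ z_gt0 G). lra.
Qed.

Lemma casorati_py (n : nat) : c n * (p n * y (S n) - p (S n) * y n) = - (1).
Proof.
  rewrite (casorati_const c w r z p y n p_rec second_rec). unfold y. rewrite p_0, q_0.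
  transitivity (- (c O * q 1%nat)); [ring|]. rewrite q_1; reflexivity.
Qed.

(** The Casoratian of [p] and [y] is -1, so the two cannot both be small around index n. Hypothesis
    [c_le] is a quantitative Carleman condition: sqrt (w_n w_{n+1}) / c_n is at least 1 / (n + M),
    whose sum diverges. *)
Lemma carleman_step (n : nat) :
  (2 * / (INR n + M) <= wmass w p n + wmass w p (S n) + (wmass w y n + wmass w y (S n)))%R.
Proof.
  (* AM-GM, as c_n is at most (n + M) sqrt (w_n w_{n+1}) *)
  assert (amgm : forall a b, (0 <= a -> 0 <= b ->
     2 * (c n * (a * b)) <= (INR n + M) * (w n * a ^ 2 + w (S n) * b ^ 2))%R).
  { intros a b Ha Hb. pose proof (pos_INR n) as Hn.
    specialize (w_gt0 n) as Hw; specialize (w_gt0 (S n)) as Hw'; specialize (c_gt0 n) as Hc.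
    apply Rsqr_incr_0_var; unfold Rsqr.
    - replace (2 * (c n * (a * b)) * (2 * (c n * (a * b))))%R
        with (c n ^ 2 * (4 * (a * b) ^ 2))%R by ring.
      eapply Rle_trans.
      { apply Rmult_le_compat_r; [|apply c_le]. pose proof (pow2_ge_0 (a * b)). lra. }
      assert (0 <= (INR n + M) ^ 2 * (w n * a ^ 2 - w (S n) * b ^ 2) ^ 2)%R
        by (apply Rmult_le_pos; apply pow2_ge_0).
      lra.
    - apply Rmult_le_pos; [lra|].
      apply Rplus_le_le_0_compat; apply Rmult_le_pos; try apply pow2_ge_0; lra. }
  pose proof (f_equal Cmod (casorati_py n)) as E.
  rewrite Cmod_m1, Cmod_mult, Cmod_R, Rabs_right in E by (apply Rle_ge, Rlt_le, c_gt0).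
  assert (T : (1 <= c n * (Cmod (p n) * Cmod (y (S n)))
               + c n * (Cmod (y n) * Cmod (p (S n))))%R).
  { rewrite <- E, <- Rmult_plus_distr_l.
    apply Rmult_le_compat_l; [apply Rlt_le, c_gt0|].
    eapply Rle_trans; [apply Cmod_triangle|].
    rewrite Cmod_opp, !Cmod_mult. lra. }
  pose proof (amgm _ _ (Cmod_ge_0 (p n)) (Cmod_ge_0 (y (S n)))) as A1.
  pose proof (amgm _ _ (Cmod_ge_0 (y n)) (Cmod_ge_0 (p (S n)))) as A2.
  unfold wmass. pose proof (pos_INR n).
  apply Rmult_le_reg_l with (INR n + M)%R; [lra|].
  replace ((INR n + M) * (2 * / (INR n + M)))%R with 2%R by (field; lra). lra.
Qed.

(** By Green's formula [Im z] times the mass of [y] beyond index 0 is a difference of two fluxes,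
    each at most [K] in absolute value. *)
Lemma mass_y_bounded : exists T : R, forall n, (sum_n (wmass w y) n <= T)%R.
Proof.
  exists (2 * K / Im z + wmass w y 0)%R. intro n.
  pose proof (flux_sum c w r z y n second_rec) as F.
  pose proof (flux_y_le n) as B1; pose proof (flux_y_le 0) as B0.
  apply Rabs_le_between in B1; apply Rabs_le_between in B0.
  apply Rmult_le_reg_l with (Im z); [lra|].
  replace (Im z * (2 * K / Im z + wmass w y 0))%R
    with (2 * K + Im z * wmass w y 0)%R by (field; lra). lra.
Qed.

Lemma mass_p_unbounded (B : R) : exists N, forall n, (N <= n)%nat -> (B < sum_n (wmass w p) n)%R.
Proof.
  destruct mass_y_bounded as [T HT].
  assert (low : forall n, (sum_n (fun k => / (INR k + M)) n
                           <= sum_n (wmass w p) (S n) + sum_n (wmass w y) (S n))%R).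
  (* Summing [carleman_step] counts inner indices twice but the last one once; keeping that deficit
     in the statement is what lets the induction close. *)
  { assert (forall n, (2 * sum_n (fun k => / (INR k + M)) n
       <= 2 * sum_n (wmass w p) (S n) + 2 * sum_n (wmass w y) (S n)
          - wmass w p (S n) - wmass w y (S n))%R) as H.
    { induction n as [|n IH].
      - rewrite !sum_Sn, !sum_O. change plus with Rplus; simpl.
        pose proof (carleman_step 0). pose proof (wmass_ge0 p 0); pose proof (wmass_ge0 y 0).
        simpl in *. lra.
      - rewrite sum_Sn, (sum_Sn _ (S n)), (sum_Sn _ (S n)). change plus with Rplus. cbv beta.
        pose proof (carleman_step (S n)). simpl in *. lra. }
    intro n; specialize (H n). pose proof (wmass_ge0 p (S n)); pose proof (wmass_ge0 y (S n)). lra. }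
  destruct (INR_unbounded (exp (B + T + ln M))) as [N HN].
  exists (S (S N)). intros n Hn.
  destruct n as [|n]; [lia|].
  specialize (low n); specialize (HT (S n)).
  pose proof (harmonic_shift_ge M n M_gt0).
  assert (B + T + ln M < ln (INR n + 1 + M))%R.
  { rewrite <- (ln_exp (B + T + ln M)). apply ln_increasing; [apply exp_pos|].
    assert (INR N <= INR n)%R by (apply le_INR; lia). lra. }
  lra.
Qed.

(** Here y_n / p_n = J - q_n / p_n, and the flux of [y], bounded by [K], is a quadratic function of
    this ratio with leading coefficient the flux of [p]. As the latter tends to infinity, the ratio
    is forced to 0. *)
Lemma weyl_disk (n : nat) :
  (Cmod (y n / p n) ^ 2 * flux c p n <= K + Cmod (y n / p n))%R.
Proof.
  pose proof (jacobi_neq0 n) as Hp. set (t := y n / p n).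
  assert (Ey : y n = t * p n) by (unfold t; field; exact Hp).
  assert (Ey1 : c n * y (S n) * p n = c n * p (S n) * y n - 1).
  { pose proof (casorati_py n) as E.
    transitivity (c n * (p n * y (S n) - p (S n) * y n) + c n * p (S n) * y n); [ring|].
    rewrite E; ring. }
  assert (Ey2 : c n * y (S n) = t * (c n * p (S n)) - / p n).
  { transitivity (c n * y (S n) * p n / p n); [field; exact Hp|].
    rewrite Ey1, Ey; field; exact Hp. }
  (* By the Casoratian, c_n y_{n+1} is t c_n p_{n+1} up to 1 / p_n; the first part contributes |t|^2
     times the flux of [p], the second a multiple of conj t by the unimodular number conj (p_n) /
     p_n. *)
  assert (F : flux c y n = (Cmod t ^ 2 * flux c p n - Im (Cconj t * (Cconj (p n) * / p n)))%R).
  { rewrite Cmod2_alt. unfold flux.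
    transitivity (Im (c n * y (S n) * Cconj (y n))).
    { destruct (y n), (y (S n)); simpl; ring. }
    rewrite Ey2, Ey. generalize (/ p n); intro ip.
    destruct t, (p n), (p (S n)), ip; simpl; ring. }
  pose proof (flux_y_le n) as B. apply Rabs_le_between in B.
  assert (Rabs (Im (Cconj t * (Cconj (p n) * / p n))) <= Cmod t)%R as B2.
  { replace (Cmod t) with (Cmod (Cconj t * (Cconj (p n) * / p n))).
    - eapply Rle_trans; [|apply Rmax_Cmod]. apply Rmax_r.
    - rewrite !Cmod_mult, !Cmod_conj, Cmod_inv by exact Hp. field.
      apply Rgt_not_eq, Cmod_gt_0, Hp. }
  apply Rabs_le_between in B2. lra.
Qed.

Lemma jacobi_limit_point : filterlim (fun n => q n / p n) eventually (locally J).
Proof.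
  assert (K_ge0 : (0 <= K)%R) by (eapply Rle_trans; [apply Rabs_pos|apply (flux_y_le O)]).
  apply (proj2 (filterlim_locally_ball_norm (U := C_NormedModule) _ J)).
  intro eps. set (e := pos eps).
  (* Threshold chosen against [weyl_disk]: if t >= e, then t^2 (K/e^2 + 1/e) = K (t/e)^2 + t (t/e)
     >= K + t. The division by [Im z] converts flux into mass. *)
  destruct (mass_p_unbounded ((K / e ^ 2 + 1 / e) / Im z)) as [N HN].
  exists N. intros n Hn. specialize (HN n Hn).
  unfold ball_norm. change (Cmod (q n / p n - J) < e)%R.
  pose proof (jacobi_neq0 n) as Hp.
  replace (q n / p n - J) with (- (y n / p n)) by (unfold y; field; exact Hp).
  rewrite Cmod_opp. pose proof (weyl_disk n) as W. rewrite flux_sum_mass in W.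
  set (t := Cmod (y n / p n)) in *. apply Rnot_le_lt. intro Ht.
  assert (He : (0 < e)%R) by apply eps.
  assert (L : (K / e ^ 2 + 1 / e < Im z * sum_n (wmass w p) n)%R).
  { apply (Rmult_lt_compat_l (Im z)) in HN; [|exact z_gt0].
    replace (Im z * ((K / e ^ 2 + 1 / e) / Im z))%R with (K / e ^ 2 + 1 / e)%R in HN
      by (field; split; lra). exact HN. }
  set (m := (Im z * sum_n (wmass w p) n)%R) in *.
  assert (t ^ 2 * (K / e ^ 2 + 1 / e) < K + t)%R.
  { eapply Rlt_le_trans; [|exact W]. apply Rmult_lt_compat_l; [apply pow_lt; lra|exact L]. }
  assert (1 <= t / e)%R as H1.
  { apply Rmult_le_reg_r with e; [lra|]. unfold Rdiv; rewrite Rmult_assoc, Rinv_l; lra. }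
  replace (t ^ 2 * (K / e ^ 2 + 1 / e))%R with (K * (t / e) ^ 2 + t * (t / e))%R in H
    by (field; lra).
  assert (1 <= (t / e) ^ 2)%R by (apply pow_R1_Rle; exact H1).
  assert (K * 1 <= K * (t / e) ^ 2)%R by (apply Rmult_le_compat_l; lra).
  assert (t * 1 <= t * (t / e))%R by (apply Rmult_le_compat_l; lra).
  lra.
Qed.
End LimitPoint.

(** * Recurrences of the Meixner--Pollaczek polynomials *)

Lemma Cexp_add (z v : C) : Cexp (z + v) = Cexp z * Cexp v.
Proof.
  destruct z as [a b], v as [a' b']; unfold Cexp, Cmult; simpl.
  rewrite exp_plus, cos_plus, sin_plus. f_equal; ring.
Qed.

Lemma Cexp_0 : Cexp 0 = 1.
Proof. unfold Cexp; simpl. rewrite exp_0, cos_0, sin_0. unfold RtoC; f_equal; ring. Qed.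

Lemma Cexp_INR (z : C) (n : nat) : Cexp (INR n * z) = Cexp z ^ n.
Proof.
  induction n as [|n IH].
  - simpl. rewrite Cmult_0_l; apply Cexp_0.
  - rewrite S_INR, RtoC_plus, Cmult_plus_distr_r, Cexp_add, IH, Cmult_1_l. simpl. ring.
Qed.

Lemma RtoC_neq0 (a : R) : (a <> 0)%R -> RtoC a <> 0.
Proof. intros H E; apply H; exact (f_equal fst E). Qed.

Definition convol (u v : nat -> C) (n : nat) : C := sum_n (fun k => u k * v (n - k)%nat) n.

(** Taylor coefficient of h^k in (1 - s h)^(-al); convolving two such sequences gives the generating
    function of the Meixner--Pollaczek polynomials. *)
Definition binom_coef (al s : C) (k : nat) : C := Cpoch al k / INR (fact k) * s ^ k.

Lemma binom_coef_rec (al s : C) (k : nat) :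
  INR (S k) * binom_coef al s (S k) = s * (al + INR k) * binom_coef al s k.
Proof.
  unfold binom_coef. rewrite fact_simpl, mult_INR, RtoC_mult. simpl Cpoch. simpl Cpow.
  field. split; apply RtoC_neq0, not_0_INR; [apply fact_neq_0|lia].
Qed.

Lemma csum_scal (a : C) (u : nat -> C) (n : nat) : sum_n (fun k => a * u k) n = a * sum_n u n.
Proof. exact (sum_n_mult_l (K := C_Ring) a u n). Qed.

Lemma csum_plus (u v : nat -> C) (n : nat) :
  sum_n (fun k => u k + v k) n = sum_n u n + sum_n v n.
Proof. exact (sum_n_plus u v n). Qed.

Lemma csum_Sl (u : nat -> C) (n : nat) :
  sum_n u (S n) = u O + sum_n (fun k => u (S k)) n.
Proof.
  induction n as [|n IH].
  - rewrite sum_Sn, !sum_O; reflexivity.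
  - rewrite sum_Sn, IH, sum_Sn. symmetry; apply Cplus_assoc.
Qed.

Lemma csum_Sr (u : nat -> C) (n : nat) : sum_n u (S n) = sum_n u n + u (S n).
Proof. exact (sum_Sn u n). Qed.

Lemma csum_ext (u v : nat -> C) (n : nat) :
  (forall k, (k <= n)%nat -> u k = v k) -> sum_n u n = sum_n v n.
Proof. intro H. apply sum_n_ext_loc. exact H. Qed.

Section Convolution.
Variables (al be s t : C).
Let u := binom_coef al s.
Let v := binom_coef be t.
Let P := convol u v.
Let X n := convol (fun k => INR k * u k) v n.
Let Y n := convol u (fun k => INR k * v k) n.

(** In terms of generating functions, [X] and [Y] apply h d/dh to the first or to the second factor,
    and together they differentiate the product. *)
Lemma convol_degree (n : nat) : X n + Y n = INR n * P n.
Proof.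
  unfold X, Y, P, convol. rewrite <- csum_plus, <- csum_scal.
  apply csum_ext. intros k Hk. rewrite minus_INR, RtoC_minus by exact Hk. ring.
Qed.

Lemma convol_stepl (n : nat) : X (S n) = s * (al * P n + X n).
Proof.
  unfold X, P, convol. rewrite csum_Sl, <- csum_scal, <- csum_plus, <- csum_scal.
  simpl (INR 0). rewrite !Cmult_0_l, Cplus_0_l.
  apply csum_ext. intros k _. simpl (S n - S k)%nat.
  unfold u at 1. rewrite binom_coef_rec. unfold u. ring.
Qed.

Lemma convol_stepr (n : nat) : Y (S n) = t * (be * P n + Y n).
Proof.
  unfold Y, P, convol. rewrite csum_Sr, <- csum_scal, <- csum_plus, <- csum_scal.
  rewrite Nat.sub_diag. simpl (INR 0). rewrite Cmult_0_l, Cmult_0_r, Cplus_0_r.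
  apply csum_ext. intros k Hk. rewrite Nat.sub_succ_l by exact Hk.
  unfold v at 1. rewrite binom_coef_rec. unfold v. ring.
Qed.

Hypothesis st : s * t = 1.

(** Coefficient form of (1 - s h)(1 - t h) F' = (s al + t be - s t (al + be) h) F for F = (1 - s
    h)^(-al) (1 - t h)^(-be). The crossed terms t X + s Y, taken one index down, both acquire the
    factor s t = 1. *)
Lemma convol_binom_rec (n : nat) :
  INR (S (S n)) * P (S (S n))
  = ((s * al + t * be) + INR (S n) * (s + t)) * P (S n) - (al + be + INR n) * P n.
Proof.
  rewrite <- convol_degree, convol_stepl, convol_stepr.
  transitivity ((s * al + t * be) * P (S n) + (s + t) * (X (S n) + Y (S n))
                - (t * X (S n) + s * Y (S n))); [ring|].
  rewrite convol_degree, (convol_stepl n), (convol_stepr n).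
  transitivity ((s * al + t * be + INR (S n) * (s + t)) * P (S n)
    - (s * t) * ((al + be) * P n + (X n + Y n))); [ring|].
  rewrite convol_degree, st. ring.
Qed.

Lemma convol_binom_0 : P 0 = 1.
Proof.
  unfold P, convol. rewrite sum_O. unfold u, v, binom_coef; simpl.
  field.
Qed.

Lemma convol_binom_1 : P 1 = s * al + t * be.
Proof.
  pose proof (convol_degree 1) as E. simpl INR in E. rewrite Cmult_1_l in E.
  rewrite <- E, convol_stepl, convol_stepr.
  assert (X0 : X 0 = 0) by (unfold X, convol; rewrite sum_O; simpl; ring).
  assert (Y0 : Y 0 = 0) by (unfold Y, convol; rewrite sum_O; simpl; ring).
  rewrite X0, Y0, convol_binom_0. ring.
Qed.
End Convolution.

Section MeixnerPollaczek.
Variables (lambda phi : R) (x : C).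

Lemma Cexp_iphi_mul : Cexp (- (Ci * phi)) * Cexp (Ci * phi) = 1.
Proof. rewrite <- Cexp_add, <- Cexp_0. f_equal; ring. Qed.

Lemma Cexp_iphi : Cexp (Ci * phi) = (cos phi, sin phi).
Proof.
  unfold Cexp; simpl.
  replace (0 * phi - 1 * 0)%R with 0%R by ring. replace (0 * 0 + 1 * phi)%R with phi by ring.
  rewrite exp_0. f_equal; ring.
Qed.

Lemma Cexp_opp_iphi : Cexp (- (Ci * phi)) = (cos phi, - sin phi)%R.
Proof.
  unfold Cexp; simpl.
  replace (- (0 * phi - 1 * 0))%R with 0%R by ring.
  replace (- (0 * 0 + 1 * phi))%R with (- phi)%R by ring.
  rewrite exp_0, cos_neg, sin_neg. f_equal; ring.
Qed.

Lemma Cexp_cos : Cexp (- (Ci * phi)) + Cexp (Ci * phi) = 2 * cos phi.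
Proof. rewrite Cexp_iphi, Cexp_opp_iphi. unfold Cplus, Cmult, RtoC; simpl. f_equal; ring. Qed.

Lemma Cexp_sin : Ci * (Cexp (- (Ci * phi)) - Cexp (Ci * phi)) = 2 * sin phi.
Proof.
  rewrite Cexp_iphi, Cexp_opp_iphi. unfold Cminus, Copp, Cplus, Cmult, Ci, RtoC; simpl. f_equal; ring.
Qed.

Lemma MP_convol (n : nat) :
  MP lambda phi x n =
  convol (binom_coef (lambda + Ci * x) (Cexp (- (Ci * phi))))
         (binom_coef (lambda - Ci * x) (Cexp (Ci * phi))) n.
Proof.
  unfold MP, convol. rewrite <- csum_scal. apply csum_ext. intros k Hk. unfold binom_coef.
  (* Split n = (n - k) + k in the prefactor: its e^{ik phi} cancels one of the two factors e^{-ik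
     phi} of the summand. *)
  replace (Ci * INR n * phi) with (INR (n - k) * (Ci * phi) + INR k * (Ci * phi)).
  2:{ rewrite minus_INR, RtoC_minus by exact Hk. ring. }
  replace (- (2 * Ci * INR k * phi))
    with (INR k * - (Ci * phi) + INR k * - (Ci * phi)) by ring.
  rewrite !Cexp_add, !Cexp_INR.
  transitivity ((Cexp (- (Ci * phi)) * Cexp (Ci * phi)) ^ k *
    (Cpoch (lambda + Ci * x) k * Cpoch (lambda - Ci * x) (n - k)
           / (INR (fact k) * INR (fact (n - k))) * Cexp (- (Ci * phi)) ^ k * Cexp (Ci * phi) ^ (n - k))).
  - rewrite Cpow_mult_l. ring.
  - rewrite Cexp_iphi_mul, Cpow_1_l. field. split; apply RtoC_neq0, INR_fact_neq_0.
Qed.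

Lemma MP_0 : MP lambda phi x 0 = 1.
Proof. rewrite MP_convol; apply convol_binom_0. Qed.

Lemma MP_middle :
  Cexp (- (Ci * phi)) * (lambda + Ci * x) + Cexp (Ci * phi) * (lambda - Ci * x)
  = 2 * (x * sin phi + lambda * cos phi).
Proof.
  transitivity (lambda * (Cexp (- (Ci * phi)) + Cexp (Ci * phi))
     + x * (Ci * (Cexp (- (Ci * phi)) - Cexp (Ci * phi)))); [ring|].
  rewrite Cexp_cos, Cexp_sin. ring.
Qed.

Lemma MP_1 : MP lambda phi x 1 = 2 * (x * sin phi + lambda * cos phi).
Proof. rewrite MP_convol, convol_binom_1. apply MP_middle. Qed.

Lemma MP_rec (n : nat) :
  INR (S (S n)) * MP lambda phi x (S (S n)) + (2 * lambda + INR n) * MP lambda phi x n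
  = 2 * (x * sin phi + (INR (S n) + lambda) * cos phi) * MP lambda phi x (S n).
Proof.
  rewrite !MP_convol, convol_binom_rec by apply Cexp_iphi_mul.
  rewrite MP_middle, Cexp_cos. ring.
Qed.

Lemma MPnum_step (n : nat) :
  INR (S (S n)) * MPnum lambda phi x (S (S n)) + (2 * lambda + INR n) * MPnum lambda phi x n
  = 2 * (x * sin phi + (INR (S n) + lambda) * cos phi) * MPnum lambda phi x (S n).
Proof.
  rewrite (MPnum_rec lambda phi x (S n)) by lia.
  replace (S n + 1)%nat with (S (S n)) by lia. replace (S n - 1)%nat with n by lia.
  rewrite (S_INR (S n)), (S_INR n), !RtoC_plus. ring.
Qed.
End MeixnerPollaczek.

(** * Calculus of complex powers along a real parameter *)

(** On the right half-plane the case split in [Carg] disappears and the argument is smooth. Both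
    bases of the integrand stay there for parameters t < 1, so the branch cut is never met. *)
Lemma Carg_atan (z : C) : (0 < Re z)%R -> Carg z = atan (Im z / Re z).
Proof.
  destruct z as [a b]; simpl; intro Ha.
  assert (Hm : (a / Cmod (a, b))%R = cos (atan (b / a))).
  { rewrite cos_atan. unfold Cmod, Rsqr; simpl.
    replace (a * (a * 1) + b * (b * 1))%R with ((a * a) * (1 + b / a * (b / a)))%R by (field; lra).
    rewrite sqrt_mult_alt by nra. rewrite sqrt_square by lra.
    assert (0 < sqrt (1 + b / a * (b / a)))%R by (apply sqrt_lt_R0; pose proof (Rle_0_sqr (b / a)); unfold Rsqr in *; lra).
    field. split; lra. }
  pose proof (atan_bound (b / a)).
  unfold Carg; simpl. rewrite Hm.
  destruct (Rle_dec 0 b) as [Hb|Hb].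
  - apply acos_cos. split; [|lra].
    rewrite <- atan_0. destruct (Rle_lt_or_eq_dec _ _ Hb) as [Hb'|<-].
    + apply Rlt_le, atan_increasing, Rdiv_lt_0_compat; assumption.
    + unfold Rdiv; rewrite Rmult_0_l; lra.
  - rewrite <- cos_neg, acos_cos; [ring|].
    assert (atan (b / a) < 0)%R; [|lra].
    rewrite <- atan_0. apply atan_increasing. apply Rnot_le_lt in Hb.
    replace (b / a)%R with (- (- b / a))%R by (field; lra).
    pose proof (Rdiv_lt_0_compat (- b) a). lra.
Qed.

Lemma Cmod_gt0_Re (z : C) : (0 < Re z)%R -> (0 < Cmod z)%R.
Proof. intro H. eapply Rlt_le_trans; [|apply re_le_Cmod]. rewrite Rabs_right; lra. Qed.

Lemma Cexp_Clog (z : C) : (0 < Re z)%R -> Cexp (Clog z) = z.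
Proof.
  intro H. pose proof (Cmod_gt0_Re z H) as Hm. unfold Cexp, Clog.
  change (Re (ln (Cmod z), Carg z)) with (ln (Cmod z)).
  change (Im (ln (Cmod z), Carg z)) with (Carg z).
  rewrite exp_ln by exact Hm. rewrite Carg_atan by exact H.
  rewrite cos_atan, sin_atan. destruct z as [a b]; simpl in *.
  assert (E : Cmod (a, b) = (a * sqrt (1 + (b / a)²))%R).
  { unfold Cmod, Rsqr; simpl.
    replace (a * (a * 1) + b * (b * 1))%R with ((a * a) * (1 + b / a * (b / a)))%R by (field; lra).
    rewrite sqrt_mult_alt by nra. rewrite sqrt_square by lra. reflexivity. }
  rewrite E.
  assert (0 < sqrt (1 + (b / a)²))%R by (apply sqrt_lt_R0; pose proof (Rle_0_sqr (b / a)); lra).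
  f_equal; field; lra.
Qed.

Lemma Cpower_succ (z al : C) : (0 < Re z)%R -> Cpower z al = z * Cpower z (al - 1).
Proof.
  intro H. unfold Cpower. rewrite <- (Cexp_Clog z H) at 2.
  unfold Cexp at 1 2 3.
  replace (al * Clog z) with (Clog z + (al - 1) * Clog z) by ring.
  generalize (Clog z) ((al - 1) * Clog z). intros [a b] [a' b'].
  unfold Cexp, Cmult, Cplus; simpl.
  rewrite exp_plus, cos_plus, sin_plus. f_equal; ring.
Qed.

Lemma Cmod_Cexp (z : C) : Cmod (Cexp z) = exp (Re z).
Proof.
  unfold Cexp, Cmod; simpl.
  replace (exp (Re z) * cos (Im z) * (exp (Re z) * cos (Im z) * 1) +
     exp (Re z) * sin (Im z) * (exp (Re z) * sin (Im z) * 1))%R with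
    (exp (Re z) * exp (Re z) * ((sin (Im z))² + (cos (Im z))²))%R by (unfold Rsqr; ring).
  rewrite sin2_cos2, Rmult_1_r. apply sqrt_square, Rlt_le, exp_pos.
Qed.

Lemma Cmod_Cpower_R (r : R) (al : C) : (0 < r)%R -> Cmod (Cpower r al) = Rpower r (Re al).
Proof.
  intro H. unfold Cpower. rewrite Cmod_Cexp. unfold Clog.
  rewrite Carg_atan by exact H. rewrite Cmod_R, Rabs_right by lra. simpl.
  replace (0 / r)%R with 0%R by (field; lra). rewrite atan_0. unfold Rpower. f_equal.
  destruct al; simpl; ring.
Qed.

(** The modulus is exp (Re al ln |z| - Im al arg z), with ln |z| controlled by [m] and [M] and the
    argument by PI. It serves the factor 1 - u e^{-i phi}, which stays away from 0. *)
Lemma Cmod_Cpower_le (m M : R) (al : C) : (0 < m)%R ->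
  exists D, (0 <= D)%R /\
  forall z, (0 < Re z)%R -> (m <= Cmod z <= M)%R -> (Cmod (Cpower z al) <= D)%R.
Proof.
  intro Hm.
  exists (exp (Rabs (Re al) * (Rabs (ln m) + Rabs (ln M)) + Rabs (Im al) * PI))%R.
  split; [apply Rlt_le, exp_pos|]. intros z Hz [H1 H2].
  unfold Cpower. rewrite Cmod_Cexp.
  assert (L : (Rabs (ln (Cmod z)) <= Rabs (ln m) + Rabs (ln M))%R).
  { pose proof (ln_le _ _ Hm H1). pose proof (ln_le (Cmod z) M ltac:(lra) H2).
    pose proof (Rle_abs (ln M)). pose proof (Rabs_pos (ln M)).
    pose proof (Rle_abs (- ln m)) as A. rewrite Rabs_Ropp in A. pose proof (Rabs_pos (ln m)).
    apply Rabs_le; lra. }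
  assert (A : (Rabs (Carg z) <= PI)%R).
  { rewrite Carg_atan by exact Hz. pose proof (atan_bound (Im z / Re z)). apply Rabs_le; lra. }
  assert (E : (Re (al * Clog z) <= Rabs (Re al) * (Rabs (ln m) + Rabs (ln M)) + Rabs (Im al) * PI)%R).
  { replace (Re (al * Clog z)) with (Re al * ln (Cmod z) + - (Im al * Carg z))%R
      by (destruct al; simpl; ring).
    apply Rplus_le_compat.
    - eapply Rle_trans; [apply Rle_abs|]. rewrite Rabs_mult.
      apply Rmult_le_compat_l; [apply Rabs_pos|exact L].
    - eapply Rle_trans; [apply Rle_abs|]. rewrite Rabs_Ropp, Rabs_mult.
      apply Rmult_le_compat_l; [apply Rabs_pos|exact A]. }
  destruct E as [E|E]; [apply Rlt_le, exp_increasing, E|rewrite E; apply Rle_refl].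
Qed.

(** Componentwise, so that real differentiation and real Riemann integration apply to each part. *)
Definition cderive (f : R -> C) (t : R) (l : C) : Prop :=
  is_derive (fun s => Re (f s)) t (Re l) /\ is_derive (fun s => Im (f s)) t (Im l).

Definition cdiff (f : R -> C) (t : R) : Prop := exists l, cderive f t l.

Lemma cderive_eq (f : R -> C) (t : R) (l l' : C) : cderive f t l -> l = l' -> cderive f t l'.
Proof. intros H <-; exact H. Qed.

Lemma cderive_ext (f g : R -> C) (t : R) (l : C) :
  (forall s, f s = g s) -> cderive f t l -> cderive g t l.
Proof.
  intros E [H1 H2]; split; eapply is_derive_ext; try eassumption; intro s; simpl; rewrite E; reflexivity.
Qed.

Lemma cderive_const (a : C) (t : R) : cderive (fun _ => a) t 0.
Proof.
  split; [exact (@is_derive_const R_AbsRing R_NormedModule (Re a) t)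
         |exact (@is_derive_const R_AbsRing R_NormedModule (Im a) t)].
Qed.

Lemma cderive_id (t : R) : cderive RtoC t 1.
Proof.
  split; [exact (@is_derive_id R_AbsRing t)
         |exact (@is_derive_const R_AbsRing R_NormedModule 0%R t)].
Qed.

Lemma cderive_plus (f g : R -> C) (t : R) (l m : C) :
  cderive f t l -> cderive g t m -> cderive (fun s => f s + g s) t (l + m).
Proof.
  intros [H1 H2] [G1 G2]; split.
  - exact (is_derive_plus (fun s => Re (f s)) (fun s => Re (g s)) t _ _ H1 G1).
  - exact (is_derive_plus (fun s => Im (f s)) (fun s => Im (g s)) t _ _ H2 G2).
Qed.

Lemma is_derive_mul (f g : R -> R) (t a b l : R) :
  is_derive f t a -> is_derive g t b -> (l = a * g t + f t * b)%R ->
  is_derive (fun s => f s * g s)%R t l.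
Proof. intros H G ->. apply (is_derive_mult f g t a b H G). intros; apply Rmult_comm. Qed.

Lemma cderive_mult (f g : R -> C) (t : R) (l m : C) :
  cderive f t l -> cderive g t m -> cderive (fun s => f s * g s) t (l * g t + f t * m).
Proof.
  intros [H1 H2] [G1 G2]; split; simpl.
  - evar_last.
    + apply (is_derive_minus (V := R_NormedModule)); eapply is_derive_mul; try eassumption; reflexivity.
    + unfold minus, plus, opp; simpl. unfold Re, Im; ring.
  - evar_last.
    + apply (is_derive_plus (V := R_NormedModule)); eapply is_derive_mul; try eassumption; reflexivity.
    + unfold plus; simpl. unfold Re, Im; ring.
Qed.

Lemma cderive_Cexp (f : R -> C) (t : R) (l : C) :
  cderive f t l -> cderive (fun s => Cexp (f s)) t (l * Cexp (f t)).
Proof.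
  intros [H1 H2]. unfold Cexp.
  assert (E1 : ex_derive (fun s => Re (f s)) t) by (eexists; exact H1).
  assert (E2 : ex_derive (fun s => Im (f s)) t) by (eexists; exact H2).
  apply is_derive_unique in H1. apply is_derive_unique in H2.
  revert E1 E2 H1 H2.
  assert (W : forall u v : R -> R, ex_derive u t -> ex_derive v t ->
    Derive u t = Re l -> Derive v t = Im l ->
    is_derive (fun s => exp (u s) * cos (v s))%R t
      (Re (l * (exp (u t) * cos (v t), exp (u t) * sin (v t))%R)) /\
    is_derive (fun s => exp (u s) * sin (v s))%R t
      (Im (l * (exp (u t) * cos (v t), exp (u t) * sin (v t))%R))).
  { intros u v E1 E2 H1 H2. split; auto_derive; auto;
      change (Derive (fun x => u x) t) with (Derive u t);
      change (Derive (fun x => v x) t) with (Derive v t);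
      rewrite H1, H2; destruct l; simpl; ring. }
  apply W.
Qed.

Lemma cderive_continuous (f : R -> C) (t : R) (l : C) : cderive f t l ->
  continuous (fun s => Re (f s)) t /\ continuous (fun s => Im (f s)) t.
Proof.
  intros [H1 H2]; split; apply (ex_derive_continuous (K := R_AbsRing) (V := R_NormedModule)); eexists; eassumption.
Qed.

Lemma cderive_Clog (f : R -> C) (t : R) (l : C) :
  cderive f t l -> (0 < Re (f t))%R -> cderive (fun s => Clog (f s)) t (l / f t).
Proof.
  intros H Hp. pose proof (cderive_continuous f t l H) as [Hc _].
  (* [Carg] agrees with atan only where the real part is positive; differentiating needs this
     agreement on a whole neighbourhood. *)
  assert (Hloc : locally t (fun s => (0 < Re (f s))%R)).
  { apply Hc. apply (open_gt 0 (Re (f t))), Hp. }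
  destruct H as [H1 H2].
  assert (E1 : ex_derive (fun s => Re (f s)) t) by (eexists; exact H1).
  assert (E2 : ex_derive (fun s => Im (f s)) t) by (eexists; exact H2).
  apply is_derive_unique in H1. apply is_derive_unique in H2.
  assert (W : forall u v : R -> R, ex_derive u t -> ex_derive v t -> (0 < u t)%R ->
    Derive u t = Re l -> Derive v t = Im l ->
    is_derive (fun s => ln (sqrt (u s ^ 2 + v s ^ 2)))%R t (Re (l / (u t, v t))) /\
    is_derive (fun s => atan (v s / u s))%R t (Im (l / (u t, v t)))).
  { intros u v F1 F2 Hu D1 D2. assert (0 < u t ^ 2 + v t ^ 2)%R by (simpl; nra). split; auto_derive.
    - repeat split; auto. apply sqrt_lt_R0; assumption.
    - change (Derive (fun x => u x) t) with (Derive u t);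
      change (Derive (fun x => v x) t) with (Derive v t).
      rewrite D1, D2.
      simpl in H. set (S := sqrt _).
      assert (ES : (S * S = u t * (u t * 1) + v t * (v t * 1))%R) by (apply sqrt_sqrt, Rlt_le, H).
      assert (HS : (0 < S)%R) by (apply sqrt_lt_R0, H).
      destruct l as [l1 l2]; simpl.
      transitivity ((l1 * u t + l2 * v t) / (S * S))%R; [field; apply Rgt_not_eq, HS|].
      rewrite ES. field. nra.
    - repeat split; auto. apply Rgt_not_eq, Hu.
    - change (Derive (fun x => u x) t) with (Derive u t);
      change (Derive (fun x => v x) t) with (Derive v t).
      rewrite D1, D2. destruct l as [l1 l2]; simpl. unfold Rsqr. field. simpl in *. repeat split; nra. }
  specialize (W (fun s => Re (f s)) (fun s => Im (f s)) E1 E2 Hp H1 H2). simpl in W.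
  destruct W as [W1 W2].
  replace (f t) with (Re (f t), Im (f t)) by (destruct (f t); reflexivity).
  split.
  - exact W1.
  - eapply is_derive_ext_loc; [|exact W2].
    apply (filter_imp _ _ (fun s Hs => eq_sym (Carg_atan (f s) Hs))), Hloc.
Qed.

Lemma cderive_Cpower (f : R -> C) (t : R) (l al : C) :
  cderive f t l -> (0 < Re (f t))%R ->
  cderive (fun s => Cpower (f s) al) t (al * l * Cpower (f t) (al - 1)).
Proof.
  intros H Hp. pose proof (Cmod_gt0_Re _ Hp) as Hm. apply Cmod_gt_0 in Hm. unfold Cpower.
  eapply cderive_eq.
  - apply cderive_Cexp. apply cderive_mult; [apply cderive_const|]. apply cderive_Clog; eassumption.
  - cbv beta. change (Cexp (al * Clog (f t))) with (Cpower (f t) al).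
    rewrite Cpower_succ by exact Hp. unfold Cpower. field. exact Hm.
Qed.

Lemma cderive_pow (f : R -> C) (t : R) (l : C) (n : nat) :
  cderive f t l -> cderive (fun s => f s ^ n) t (INR n * l * f t ^ pred n).
Proof.
  intro H; induction n as [|n IH].
  - apply cderive_ext with (f := fun _ => 1); [reflexivity|].
    apply cderive_eq with (RtoC 0); [apply cderive_const|]. simpl; ring.
  - apply cderive_ext with (f := fun s => f s * f s ^ n); [reflexivity|].
    eapply cderive_eq.
    + apply cderive_mult; [exact H|exact IH].
    + cbv beta. rewrite S_INR, RtoC_plus. simpl pred. destruct n; simpl; ring.
Qed.

(** * Integrals over [0, T] of complex-valued functions *)

Definition cint (f : R -> C) (T : R) : C :=
  (RInt (fun t => Re (f t)) 0 T, RInt (fun t => Im (f t)) 0 T).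

Lemma cdiff_integrable (f : R -> C) (a T : R) : (a <= T)%R ->
  (forall t, (a <= t <= T)%R -> cdiff f t) ->
  ex_RInt (fun t => Re (f t)) a T /\ ex_RInt (fun t => Im (f t)) a T.
Proof.
  intros HT H; split; apply (ex_RInt_continuous (V := R_CompleteNormedModule)); intros t Ht;
    rewrite Rmin_left, Rmax_right in Ht by exact HT;
    destruct (H t Ht) as [l Hl]; apply (cderive_continuous f t l Hl).
Qed.

Lemma cint_derive (f df : R -> C) (T : R) : (0 <= T)%R ->
  (forall t, (0 <= t <= T)%R -> cderive f t (df t)) ->
  (forall t, (0 <= t <= T)%R -> cdiff df t) ->
  cint df T = f T - f 0%R.
Proof.
  intros HT H D. unfold cint.
  replace (f T - f 0%R) with (Re (f T) - Re (f 0%R), Im (f T) - Im (f 0%R))%R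
    by (destruct (f T), (f 0%R); reflexivity).
  f_equal; apply is_RInt_unique;
    [apply (is_RInt_derive (V := R_CompleteNormedModule) (fun t => Re (f t)))|apply (is_RInt_derive (V := R_CompleteNormedModule) (fun t => Im (f t)))];
    intros t Ht; rewrite Rmin_left, Rmax_right in Ht by exact HT;
    try (apply H; exact Ht); destruct (D t Ht) as [l Hl]; apply (cderive_continuous df t l Hl).
Qed.

Lemma cint_plus (f g : R -> C) (T : R) : (0 <= T)%R ->
  (forall t, (0 <= t <= T)%R -> cdiff f t) -> (forall t, (0 <= t <= T)%R -> cdiff g t) ->
  cint (fun t => f t + g t) T = cint f T + cint g T.
Proof.
  intros HT Hf Hg. destruct (cdiff_integrable f 0 T HT Hf), (cdiff_integrable g 0 T HT Hg).
  unfold cint. unfold Cplus at 3; simpl.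
  f_equal; apply (RInt_plus (V := R_CompleteNormedModule)); assumption.
Qed.

Lemma cint_scal (a : C) (f : R -> C) (T : R) : (0 <= T)%R ->
  (forall t, (0 <= t <= T)%R -> cdiff f t) ->
  cint (fun t => a * f t) T = a * cint f T.
Proof.
  intros HT Hf. destruct (cdiff_integrable f 0 T HT Hf) as [E1 E2].
  unfold cint. destruct a as [a b]. unfold Cmult at 3; simpl.
  assert (S : forall k (h : R -> R), ex_RInt h 0 T ->
            is_RInt (fun t => k * h t)%R 0 T (k * RInt h 0 T)%R).
  { intros k h Hh. apply (is_RInt_scal (V := R_NormedModule) h 0 T k).
    apply (RInt_correct (V := R_CompleteNormedModule)), Hh. }
  f_equal; apply is_RInt_unique.
  - apply (is_RInt_minus (V := R_NormedModule)); apply S; assumption.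
  - apply (is_RInt_plus (V := R_NormedModule)); apply S; assumption.
Qed.

Lemma cdiff_plus (f g : R -> C) (t : R) : cdiff f t -> cdiff g t -> cdiff (fun s => f s + g s) t.
Proof. intros [l H] [m G]; eexists; apply cderive_plus; eassumption. Qed.

Lemma cdiff_mult (f g : R -> C) (t : R) : cdiff f t -> cdiff g t -> cdiff (fun s => f s * g s) t.
Proof. intros [l H] [m G]; eexists; apply cderive_mult; eassumption. Qed.

Lemma cdiff_const (a : C) (t : R) : cdiff (fun _ => a) t.
Proof. eexists; apply cderive_const. Qed.

(** Applied both with e^{-2i phi} and with 1, which is why [kernel] writes [1 - t * 1]. *)
Lemma cderive_affine (om : C) (t : R) : cderive (fun s => 1 - s * om) t (- om).
Proof.
  eapply cderive_ext with (f := fun s => 1 + (- om) * s).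
  - intro s; ring.
  - eapply cderive_eq.
    + apply cderive_plus; [apply cderive_const|].
      apply cderive_mult; [apply cderive_const|apply cderive_id].
    + cbv beta. ring.
Qed.

(** * Powers of 1 - t, improper integrals and truncated Beta integrals *)

Lemma is_derive_Rpower_compl (b t : R) : (t < 1)%R ->
  is_derive (fun s => Rpower (1 - s) b) t (- b * Rpower (1 - t) (b - 1))%R.
Proof.
  intro Ht. unfold Rpower. auto_derive; [lra|].
  replace ((b - 1) * ln (1 - t))%R with (b * ln (1 - t) + - ln (1 - t))%R by ring.
  rewrite exp_plus, exp_Ropp, exp_ln by lra. unfold Rminus. field. lra.
Qed.

Lemma continuous_Rpower_compl (b t : R) : (t < 1)%R ->
  continuous (fun s => Rpower (1 - s) b) t.
Proof.
  intro Ht. apply (ex_derive_continuous (K := R_AbsRing) (V := R_NormedModule)).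
  eexists. apply is_derive_Rpower_compl, Ht.
Qed.

Lemma Rpower_ge0 (a b : R) : (0 <= Rpower a b)%R.
Proof. apply Rlt_le, exp_pos. Qed.

Lemma is_RInt_Rpower_compl (b T T' : R) : (0 < b)%R -> (T <= T' < 1)%R ->
  is_RInt (fun t => Rpower (1 - t) (b - 1)) T T' ((Rpower (1 - T) b - Rpower (1 - T') b) / b)%R.
Proof.
  intros Hb [HT HT'].
  replace ((Rpower (1 - T) b - Rpower (1 - T') b) / b)%R
    with (minus ((- / b) * Rpower (1 - T') b) ((- / b) * Rpower (1 - T) b))%R
    by (unfold minus, plus, opp; simpl; field; lra).
  apply (is_RInt_derive (V := R_CompleteNormedModule) (fun t => (- / b) * Rpower (1 - t) b)%R);
    intros t Ht; rewrite Rmin_left, Rmax_right in Ht by exact HT.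
  - evar_last.
    + apply is_derive_scal, is_derive_Rpower_compl; lra.
    + field; lra.
  - apply continuous_Rpower_compl; lra.
Qed.

(** The rate, which is the tail of the integrated majorant, matters as much as the limit: it starts
    the induction of [second_kind_moment]. *)
Lemma improper_limit (f : R -> R) (D b : R) : (0 < b)%R ->
  (forall t, (0 <= t < 1)%R -> continuous f t) ->
  (forall t, (0 <= t < 1)%R -> (Rabs (f t) <= D * Rpower (1 - t) (b - 1))%R) ->
  exists j, forall T, (0 <= T < 1)%R -> (Rabs (j - RInt f 0 T) <= D / b * Rpower (1 - T) b)%R.
Proof.
  intros Hb Hc Hf.
  assert (HD : (0 <= D)%R).
  { pose proof (Hf 0%R ltac:(lra)) as H. pose proof (Rabs_pos (f 0%R)) as H'.
    assert (0 < Rpower (1 - 0) (b - 1))%R as Hp by apply exp_pos.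
    apply Rnot_lt_le; intro Hn. nra. }
  (* F - m increases, F + m decreases and m tends to 0, where F T = RInt f 0 T *)
  set (m := fun T => (D / b * Rpower (1 - T) b)%R).
  assert (Hm : forall T, (0 <= m T)%R).
  { intro T. apply Rmult_le_pos; [|apply Rpower_ge0].
    apply Rmult_le_pos; [exact HD|apply Rlt_le, Rinv_0_lt_compat, Hb]. }
  assert (ex : forall T T', (0 <= T <= T')%R -> (T' < 1)%R -> ex_RInt f T T').
  { intros T T' H H'. apply (ex_RInt_continuous (V := R_CompleteNormedModule)).
    intros t Ht. rewrite Rmin_left, Rmax_right in Ht by lra. apply Hc; lra. }
  assert (osc : forall T T', (0 <= T <= T')%R -> (T' < 1)%R ->
     (Rabs (RInt f 0 T' - RInt f 0 T) <= m T - m T')%R).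
  { intros T T' H H'.
    assert (E : (RInt f 0 T' = RInt f 0 T + RInt f T T')%R).
    { symmetry. apply (RInt_Chasles (V := R_CompleteNormedModule)); apply ex; lra. }
    assert (E' : forall u v s : R, (u = v + s -> u - v = s)%R) by (intros; lra).
    rewrite (E' _ _ _ E).
    eapply Rle_trans; [apply abs_RInt_le; [lra|apply ex; lra]|].
    pose proof (is_RInt_scal (V := R_NormedModule) _ _ _ D _
      (is_RInt_Rpower_compl b T T' Hb ltac:(lra))) as I.
    replace (m T - m T')%R with (RInt (fun t => D * Rpower (1 - t) (b - 1))%R T T').
    - apply RInt_le; [lra| | |].
      + apply (ex_RInt_norm f), ex; lra.
      + eexists; exact I.
      + intros t Ht; apply Hf; lra.
    - etransitivity; [exact (is_RInt_unique (V := R_CompleteNormedModule) _ _ _ _ I)|].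
      unfold m, scal; simpl; unfold mult; simpl. field; lra. }
  destruct (completeness (fun y => exists T, (0 <= T < 1)%R /\ y = (RInt f 0 T - m T)%R)) as [j [U L]].
  - exists (RInt f 0 0 + m 0)%R. intros y [T [HT ->]].
    pose proof (osc 0%R T ltac:(lra) ltac:(lra)) as O. apply Rabs_le_between in O.
    pose proof (Hm T); pose proof (Hm 0%R). lra.
  - exists (RInt f 0 0 - m 0)%R, 0%R. split; [lra|reflexivity].
  - exists j. intros T HT. apply Rabs_le. fold (m T). split.
    + pose proof (U _ (ex_intro _ T (conj HT eq_refl))). lra.
    + enough (j <= RInt f 0 T + m T)%R by lra.
      apply L. intros y [S [HS ->]]. pose proof (Hm T); pose proof (Hm S).
      destruct (Rle_dec S T) as [H1|H1].
      * pose proof (osc S T ltac:(lra) ltac:(lra)) as O. apply Rabs_le_between in O. lra.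
      * pose proof (osc T S ltac:(lra) ltac:(lra)) as O. apply Rabs_le_between in O. lra.
Qed.

Lemma Rpower_compl_small (b e : R) : (0 < b)%R -> (0 < e)%R ->
  exists T0, (0 <= T0 < 1)%R /\ forall T, (T0 <= T < 1)%R -> (Rpower (1 - T) b <= e)%R.
Proof.
  intros Hb He.
  set (d := Rmin 1 (Rpower e (/ b))).
  assert (Hd : (0 < d <= 1)%R).
  { split; [apply Rmin_glb_lt; [lra|apply exp_pos]|apply Rmin_l]. }
  exists (1 - d)%R. split; [lra|]. intros T HT.
  replace e with (Rpower (Rpower e (/ b)) b).
  - apply Rle_Rpower_l; [lra|]. split; [lra|]. pose proof (Rmin_r 1 (Rpower e (/ b))). unfold d in *. lra.
  - rewrite Rpower_mult, Rinv_l by lra. apply Rpower_1, He.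
Qed.

Definition beta_int (b : R) (n : nat) (T : R) : R :=
  RInt (fun t => t ^ n * Rpower (1 - t) (b - 1))%R 0 T.

(** The Beta value B(n+1, b) = n! / (b (b+1) ... (b+n)), in a product form that compares step by
    step with [weight]. *)
Fixpoint beta_bound (b : R) (n : nat) : R :=
  match n with
  | O => (/ b)%R
  | S m => (beta_bound b m * (INR (S m) / (INR (S m) + b)))%R
  end.

Lemma continuous_beta (b : R) (n : nat) (t : R) : (t < 1)%R ->
  continuous (fun s => s ^ n * Rpower (1 - s) (b - 1))%R t.
Proof.
  intro Ht. apply (continuous_mult (K := R_AbsRing) (fun s => s ^ n)%R).
  - apply (ex_derive_continuous (K := R_AbsRing) (V := R_NormedModule)). auto_derive; exact I.
  - apply continuous_Rpower_compl, Ht.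
Qed.

Lemma ex_RInt_beta (b : R) (n : nat) (T : R) : (0 <= T < 1)%R ->
  ex_RInt (fun t => t ^ n * Rpower (1 - t) (b - 1))%R 0 T.
Proof.
  intro HT. apply (ex_RInt_continuous (V := R_CompleteNormedModule)). intros t Ht.
  rewrite Rmin_left, Rmax_right in Ht by lra. apply continuous_beta; lra.
Qed.

(** Integrates the derivative of t^(n+1) (1-t)^b over [0, T]. *)
Lemma beta_int_rec (b : R) (n : nat) (T : R) : (0 <= T < 1)%R ->
  (INR (S n) * beta_int b n T - (INR (S n) + b) * beta_int b (S n) T
   = T ^ S n * Rpower (1 - T) b)%R.
Proof.
  intro HT.
  assert (I1 : is_RInt (fun t => INR (S n) * (t ^ n * Rpower (1 - t) (b - 1))
                 - (INR (S n) + b) * (t ^ S n * Rpower (1 - t) (b - 1)))%R 0 T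
               (INR (S n) * beta_int b n T - (INR (S n) + b) * beta_int b (S n) T)%R).
  { apply (is_RInt_minus (V := R_NormedModule));
      apply (is_RInt_scal (V := R_NormedModule));
      apply (RInt_correct (V := R_CompleteNormedModule)), ex_RInt_beta, HT. }
  rewrite <- (is_RInt_unique (V := R_CompleteNormedModule) _ _ _ _ I1). apply is_RInt_unique.
  replace (T ^ S n * Rpower (1 - T) b)%R
    with (minus (T ^ S n * Rpower (1 - T) b) (0 ^ S n * Rpower (1 - 0) b))%R
    by (unfold minus, plus, opp; simpl; ring).
  apply (is_RInt_derive (V := R_CompleteNormedModule) (fun t => t ^ S n * Rpower (1 - t) b)%R);
    intros t Ht; rewrite Rmin_left, Rmax_right in Ht by lra.
  - eapply is_derive_mul.
    + apply is_derive_pow, is_derive_id.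
    + apply is_derive_Rpower_compl; lra.
    + assert (E : Rpower (1 - t) b = ((1 - t) * Rpower (1 - t) (b - 1))%R).
      { rewrite <- (Rpower_1 (1 - t)) at 2 by lra. rewrite <- Rpower_plus. f_equal; ring. }
      cbv beta. rewrite E. change (pred (S n)) with n. rewrite <- !tech_pow_Rmult. change one with 1%R. ring.
  - apply (continuous_minus (V := R_NormedModule));
      apply (continuous_scal_r (K := R_AbsRing) (V := R_NormedModule)); apply continuous_beta; lra.
Qed.

(** The boundary term of [beta_int_rec] is nonnegative, so the truncated integrals obey the Beta
    recursion as an inequality, uniformly in T. *)
Lemma beta_int_le (b : R) (n : nat) (T : R) : (0 < b)%R -> (0 <= T < 1)%R ->
  (beta_int b n T <= beta_bound b n)%R.
Proof.
  intros Hb HT; induction n as [|n IH].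
  - simpl. unfold beta_int.
    rewrite (RInt_ext _ (fun t => Rpower (1 - t) (b - 1))) by (intros; simpl; ring).
    rewrite (is_RInt_unique _ _ _ _ (is_RInt_Rpower_compl b 0 T Hb ltac:(lra))).
    rewrite Rminus_0_r.
    assert (Rpower 1 b = 1)%R as -> by (unfold Rpower; rewrite ln_1, Rmult_0_r; apply exp_0).
    pose proof (Rpower_ge0 (1 - T) b). pose proof (Rinv_0_lt_compat b Hb). unfold Rdiv. nra.
  - pose proof (beta_int_rec b n T HT) as R. pose proof (pos_INR (S n)) as Hn.
    assert (0 <= T ^ S n * Rpower (1 - T) b)%R
      by (apply Rmult_le_pos; [apply pow_le; lra|apply Rpower_ge0]).
    simpl beta_bound.
    apply Rmult_le_reg_l with (INR (S n) + b)%R; [lra|].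
    match goal with |- (_ <= ?r)%R => replace r with (INR (S n) * beta_bound b n)%R by (simpl INR in *; field; lra) end.
    assert (INR (S n) * beta_int b n T <= INR (S n) * beta_bound b n)%R
      by (apply Rmult_le_compat_l; assumption). lra.
Qed.

(** * The second-kind solution as an integral *)

Lemma cdiff_linear3 (f g h : R -> C) (a b c : C) (t : R) :
  cdiff f t -> cdiff g t -> cdiff h t -> cdiff (fun s => a * f s + b * g s + c * h s) t.
Proof.
  intros Hf Hg Hh. apply (cdiff_plus (fun s => a * f s + b * g s)).
  - apply (cdiff_plus (fun s => a * f s));
      apply cdiff_mult; solve [assumption|apply cdiff_const].
  - apply cdiff_mult; [apply cdiff_const|assumption].
Qed.

Lemma cint_linear3 (f g h : R -> C) (a b c : C) (T : R) : (0 <= T)%R ->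
  (forall t, (0 <= t <= T)%R -> cdiff f t) -> (forall t, (0 <= t <= T)%R -> cdiff g t) ->
  (forall t, (0 <= t <= T)%R -> cdiff h t) ->
  cint (fun t => a * f t + b * g t + c * h t) T = a * cint f T + b * cint g T + c * cint h T.
Proof.
  intros HT Hf Hg Hh.
  assert (S : forall k u, (forall t, (0 <= t <= T)%R -> cdiff u t) ->
     forall t, (0 <= t <= T)%R -> cdiff (fun s => k * u s) t).
  { intros k u Hu t Ht; apply cdiff_mult; [apply cdiff_const|apply Hu, Ht]. }
  rewrite (cint_plus (fun t => a * f t + b * g t)), (cint_plus (fun t => a * f t)), !cint_scal;
    auto.
  intros t Ht; apply cdiff_plus; apply S; assumption.
Qed.

(** The factor 2 comes from bounding real and imaginary parts separately; constants are immaterial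
    here. *)
Lemma Cmod_cint_le (f : R -> C) (g : R -> R) (T : R) : (0 <= T)%R ->
  (forall t, (0 <= t <= T)%R -> cdiff f t) -> ex_RInt g 0 T ->
  (forall t, (0 <= t <= T)%R -> (Cmod (f t) <= g t)%R) ->
  (Cmod (cint f T) <= 2 * RInt g 0 T)%R.
Proof.
  intros HT Hf Hg Hb. destruct (cdiff_integrable f 0 T HT Hf) as [E1 E2].
  assert (B : forall u : R -> R, ex_RInt u 0 T -> (forall t, (0 <= t <= T)%R -> (Rabs (u t) <= g t)%R) ->
     (Rabs (RInt u 0 T) <= RInt g 0 T)%R).
  { intros u Hu Hug. eapply Rle_trans; [apply abs_RInt_le; assumption|].
    apply RInt_le; [assumption|apply (ex_RInt_norm u), Hu|assumption|].
    intros t Ht; apply Hug; lra. }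
  assert (B1 := B (fun t => Re (f t)) E1).
  assert (B2 := B (fun t => Im (f t)) E2).
  unfold cint. set (r1 := RInt (fun t => Re (f t)) 0 T) in *. set (r2 := RInt (fun t => Im (f t)) 0 T) in *.
  replace ((r1, r2) : C) with (r1 + Ci * r2) by (unfold Cplus, Cmult, Ci, RtoC; simpl; f_equal; ring).
  eapply Rle_trans; [apply Cmod_triangle|]. rewrite Cmod_mult, Cmod_Ci, !Cmod_R.
  enough (Rabs r1 <= RInt g 0 T /\ Rabs r2 <= RInt g 0 T)%R by lra.
  split; [apply B1|apply B2]; intros t Ht; eapply Rle_trans; try apply (Hb t Ht);
    (eapply Rle_trans; [|apply Rmax_Cmod]); [apply Rmax_l|apply Rmax_r].
Qed.

Section Kernel.
Variables (lambda phi : R) (x : C).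
Hypotheses (lambda_gt0 : (0 < lambda)%R) (phi_gt0 : (0 < phi)%R) (phi_lt : (phi < PI)%R).
Hypothesis x_gt0 : (0 < Im x)%R.
Let a := Cexp (- (Ci * phi)).
Let om := a * a.
Let A := lambda + Ci * x.
Let B := lambda - Ci * x.
(** This is the real part of [B]: near t = 1 the integrand has size (1-t)^(b-1). *)
Let b := (lambda + Im x)%R.

(* The path u = t a: there 1 - u e^{i phi} = 1 - t and 1 - u e^{-i phi} = 1 - t om. *)
Definition kernel (n : nat) (be al : C) (t : R) : C :=
  (t * a) ^ n * (Cpower (1 - t * 1) be * Cpower (1 - t * om) al).

Lemma sin_phi_gt0 : (0 < sin phi)%R.
Proof. apply sin_gt_0; assumption. Qed.

Lemma om_val : om = ((cos phi) ^ 2 - (sin phi) ^ 2, - (2 * sin phi * cos phi))%R.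
Proof.
  unfold om, a. rewrite Cexp_opp_iphi. unfold Cmult; simpl. f_equal; ring.
Qed.

Lemma cos2_sin2 : ((cos phi) ^ 2 = 1 - (sin phi) ^ 2)%R.
Proof. pose proof (sin2_cos2 phi) as H. unfold Rsqr in H. simpl. lra. Qed.

Lemma sin2_le1 : (0 < sin phi ^ 2 <= 1)%R.
Proof.
  pose proof sin_phi_gt0. pose proof cos2_sin2 as H1. pose proof (pow2_ge_0 (cos phi)).
  split; [apply pow_lt; assumption|lra].
Qed.

Lemma Re_compl1 (t : R) : (t < 1)%R -> (0 < Re (1 - t * 1))%R.
Proof. intro H; simpl; lra. Qed.

(** As [om] is e^{-2i phi}, the real part is 1 - t cos (2 phi). Negative t are included because
    derivatives at the endpoint 0 are two-sided. *)
Lemma Re_compl_om (t : R) : (-1 < t < 1)%R -> (0 < Re (1 - t * om))%R.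
Proof.
  intro H. rewrite om_val. pose proof sin2_le1. simpl in *. pose proof cos2_sin2 as E; simpl in E.
  rewrite E. nra.
Qed.

Lemma Cmod_compl_om (t : R) : (0 <= t < 1)%R -> (sin phi <= Cmod (1 - t * om) <= 2)%R.
Proof.
  intro H. pose proof sin_phi_gt0 as Hs. split.
  - apply Rsqr_incr_0_var; [|apply Cmod_ge_0]. rewrite !Rsqr_pow2, Cmod2_alt.
    pose proof sin2_le1 as Hs2. pose proof cos2_sin2 as Hc.
    set (s := sin phi) in *. set (c := cos phi) in *.
    assert (E : (Re (1 - t * om) ^ 2 + Im (1 - t * om) ^ 2
                 = (1 - t * (c ^ 2 - s ^ 2)) ^ 2 + 4 * t ^ 2 * s ^ 2 * c ^ 2)%R).
    { rewrite om_val. fold s c. simpl. ring. }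
    rewrite E, Hc.
    (* With s = sin phi, |1 - t om|^2 - s^2 is exactly (1-t)^2 (1-s^2) + s^2 t (t+2). *)
    assert (0 <= (1 - t) ^ 2 * (1 - s ^ 2))%R by (apply Rmult_le_pos; [apply pow2_ge_0|lra]).
    assert (0 <= s ^ 2 * (t * (t + 2)))%R by (apply Rmult_le_pos; [lra|nra]).
    lra.
  - unfold Cminus. eapply Rle_trans; [apply Cmod_triangle|].
    rewrite Cmod_opp, !Cmod_mult, Cmod_1, Cmod_R, (Rabs_right t) by lra.
    unfold om. rewrite Cmod_mult. unfold a; rewrite Cmod_Cexp. simpl.
    replace (- (0 * phi - 1 * 0))%R with 0%R by ring. rewrite exp_0. lra.
Qed.

Lemma Cmod_a : Cmod a = 1%R.
Proof.
  unfold a; rewrite Cmod_Cexp. simpl.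
  replace (- (0 * phi - 1 * 0))%R with 0%R by ring. apply exp_0.
Qed.

Lemma kernel_derive (n : nat) (be al : C) (t : R) : (-1 < t < 1)%R ->
  cderive (kernel n be al) t
    (INR n * a * kernel (pred n) be al t
     - (be * kernel n (be - 1) al t + al * om * kernel n be (al - 1) t)).
Proof.
  intro Ht. unfold kernel. eapply cderive_eq.
  - apply cderive_mult.
    + apply cderive_pow. apply cderive_mult; [apply cderive_id|apply cderive_const].
    + apply cderive_mult; apply cderive_Cpower; try apply cderive_affine.
      * apply Re_compl1; lra.
      * apply Re_compl_om; exact Ht.
  - cbv beta. ring.
Qed.

Lemma kernel_cdiff (n : nat) (be al : C) (t : R) : (-1 < t < 1)%R -> cdiff (kernel n be al) t.
Proof. intro Ht; eexists; apply kernel_derive, Ht. Qed.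

Lemma kernel_bound (be al : C) : exists D, (0 <= D)%R /\ forall n t, (0 <= t < 1)%R ->
  (Cmod (kernel n be al t) <= D * (t ^ n * Rpower (1 - t) (Re be)))%R.
Proof.
  destruct (Cmod_Cpower_le (sin phi) 2 al sin_phi_gt0) as [D [HD H]].
  exists D; split; [exact HD|]. intros n t Ht. unfold kernel.
  rewrite !Cmod_mult, Cmod_pow, Cmod_mult, Cmod_a, Cmod_R, Rabs_right, Rmult_1_r by lra.
  replace (1 - t * 1) with (RtoC (1 - t)) by (rewrite RtoC_minus; ring).
  rewrite Cmod_Cpower_R by lra.
  replace (D * (t ^ n * Rpower (1 - t) (Re be)))%R with (t ^ n * (Rpower (1 - t) (Re be) * D))%R by ring.
  apply Rmult_le_compat_l; [apply pow_le; lra|].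
  apply Rmult_le_compat_l; [apply Rpower_ge0|].
  apply H; [apply Re_compl_om; lra|apply Cmod_compl_om, Ht].
Qed.

(** The outer [a] is du/dt, so [moment n T] is the integral defining g_n, stopped at u = T a. *)
Definition moment_kernel (n : nat) (t : R) : C := a * kernel n (B - 1) (A - 1) t.

Definition moment (n : nat) (T : R) : C := cint (moment_kernel n) T.

Let mid (n : nat) : C := 2 * (x * sin phi + (INR n + lambda) * cos phi).

Lemma moment_cdiff (n : nat) (t : R) : (-1 < t < 1)%R -> cdiff (moment_kernel n) t.
Proof. intro H; apply cdiff_mult; [apply cdiff_const|apply kernel_cdiff, H]. Qed.

Lemma a_conj : a * Cexp (Ci * phi) = 1.
Proof. apply Cexp_iphi_mul. Qed.

(** Once the powers with exponents B - 1 and A - 1 are factored out, a polynomial in u remains; a +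
    1/a = 2 cos phi and A + B = 2 lambda turn its coefficients into those of the recurrence. At n =
    0 the term with [pred n] carries the factor 0. *)
Lemma boundary_derive (n : nat) (t : R) : (-1 < t < 1)%R ->
  cderive (kernel n B A) t
    (INR n * moment_kernel (pred n) t + - mid n * moment_kernel n t
     + (INR n + 2 * lambda) * moment_kernel (S n) t).
Proof.
  intro Ht. eapply cderive_eq; [apply kernel_derive, Ht|].
  unfold moment_kernel, kernel.
  rewrite (Cpower_succ (1 - t * 1) B) by (apply Re_compl1; lra).
  rewrite (Cpower_succ (1 - t * om) A) by (apply Re_compl_om, Ht).
  generalize (Cpower (1 - t * 1) (B - 1)) (Cpower (1 - t * om) (A - 1)); intros e1 e2.
  assert (E1 : B + A * om = a * (2 * (x * sin phi + lambda * cos phi))).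
  { rewrite <- MP_middle. fold a. change (lambda + Ci * x) with A. change (lambda - Ci * x) with B.
    transitivity ((a * Cexp (Ci * phi)) * B + A * om); [rewrite a_conj; ring|unfold om; ring]. }
  assert (E2 : 1 + om = a * (2 * cos phi)).
  { rewrite <- Cexp_cos. fold a.
    transitivity ((a * Cexp (Ci * phi)) + om); [rewrite a_conj; ring|unfold om; ring]. }
  assert (E3 : A + B = 2 * lambda) by (unfold A, B; ring).
  assert (E4 : mid n = 2 * (x * sin phi + lambda * cos phi) + INR n * (2 * cos phi))
    by (unfold mid; ring).
  rewrite E4.
  transitivity (((INR n * a * (t * a) ^ pred n) * (1 - t * (1 + om) + t * t * om)
    - (t * a) ^ n * ((B + A * om) - (A + B) * t * om)) * (e1 * e2)); [ring|].
  rewrite E1, E2, E3.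
  destruct n as [|m].
  - simpl. unfold om. ring.
  - simpl pred. simpl Cpow. unfold om. ring.
Qed.

Lemma moment_rec (n : nat) (T : R) : (0 <= T < 1)%R ->
  INR n * moment (pred n) T + - mid n * moment n T + (INR n + 2 * lambda) * moment (S n) T
  = kernel n B A T - kernel n B A 0%R.
Proof.
  intro HT. unfold moment. rewrite <- cint_linear3.
  - apply cint_derive; [lra| |].
    + intros t Ht; apply boundary_derive; lra.
    + intros t Ht. apply cdiff_linear3; apply moment_cdiff; lra.
  - lra.
  - intros t Ht; apply moment_cdiff; lra.
  - intros t Ht; apply moment_cdiff; lra.
  - intros t Ht; apply moment_cdiff; lra.
Qed.

Lemma kernel_at0 (n : nat) : kernel n B A 0%R = match n with O => 1 | S _ => 0 end.
Proof.
  unfold kernel. destruct n as [|n].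
  - assert (E : forall al, Cpower 1 al = 1).
    { intro al. unfold Cpower, Clog. rewrite Cmod_1, ln_1, Carg_atan by (simpl; lra). simpl.
      replace (0 / 1)%R with 0%R by field. rewrite atan_0.
      change (Cexp (al * 0) = 1). rewrite Cmult_0_r. apply Cexp_0. }
    replace (1 - 0%R * 1) with (RtoC 1) by ring. replace (1 - 0%R * om) with (RtoC 1) by ring.
    rewrite !E. simpl. ring.
  - simpl. ring.
Qed.

(** * The weights and the second-kind solution *)

Fixpoint weight (n : nat) : R :=
  match n with
  | O => 1
  | S m => weight m * (INR (S m) / (INR m + 2 * lambda))
  end%R.

Lemma weight_gt0 (n : nat) : (0 < weight n)%R.
Proof.
  induction n as [|n IH]; [simpl; lra|].
  change (weight (S n)) with (weight n * (INR (S n) / (INR n + 2 * lambda)))%R.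
  pose proof (pos_INR n). apply Rmult_lt_0_compat; [exact IH|].
  apply Rdiv_lt_0_compat; [apply lt_0_INR; lia|lra].
Qed.

Lemma weight_S (n : nat) : ((INR n + 2 * lambda) * weight (S n) = INR (S n) * weight n)%R.
Proof.
  change (weight (S n)) with (weight n * (INR (S n) / (INR n + 2 * lambda)))%R.
  pose proof (pos_INR n). field. lra.
Qed.

Definition MPassoc (n : nat) : C := MPnum lambda phi x n / (2 * sin phi).

Lemma MPassoc_rec (n : nat) :
  INR (S (S n)) * MPassoc (S (S n)) + (2 * lambda + INR n) * MPassoc n = mid (S n) * MPassoc (S n).
Proof.
  pose proof (MPnum_step lambda phi x n) as E. unfold MPassoc, mid.
  assert (H1 : RtoC (sin phi) <> 0).
  { apply RtoC_neq0, Rgt_not_eq, sin_phi_gt0. }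
  transitivity ((INR (S (S n)) * MPnum lambda phi x (S (S n))
     + (2 * lambda + INR n) * MPnum lambda phi x n) / (2 * sin phi)); [field; exact H1|].
  rewrite E. field. exact H1.
Qed.

Lemma MPassoc_0 : MPassoc 0 = 0.
Proof. unfold MPassoc. simpl. unfold Cdiv; ring. Qed.

Lemma MPassoc_1 : MPassoc 1 = 1.
Proof.
  unfold MPassoc. simpl. field.
  apply RtoC_neq0, Rgt_not_eq, sin_phi_gt0.
Qed.

Definition second_kind (J : C) (n : nat) : C := J * MP lambda phi x n - MPassoc n.

(** This is [moment_rec] without the boundary term at T, for any [J]. At n = 0 the inhomogeneity -1
    comes from [MPassoc_1], so [J] only fixes the initial value. *)
Lemma second_kind_rec (J : C) (n : nat) :
  INR n * (weight (pred n) * second_kind J (pred n)) + - mid n * (weight n * second_kind J n)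
  + (INR n + 2 * lambda) * (weight (S n) * second_kind J (S n))
  = - kernel n B A 0%R.
Proof.
  rewrite kernel_at0. unfold second_kind.
  pose proof (f_equal RtoC (weight_S n)) as E. rewrite !RtoC_mult, RtoC_plus, RtoC_mult in E.
  transitivity (INR n * weight (pred n) * (J * MP lambda phi x (pred n) - MPassoc (pred n))
   + - mid n * (weight n * (J * MP lambda phi x n - MPassoc n))
   + ((INR n + 2 * lambda) * weight (S n)) * (J * MP lambda phi x (S n) - MPassoc (S n))); [ring|].
  rewrite E. destruct n as [|n].
  - simpl pred. rewrite MP_0, MP_1, MPassoc_0, MPassoc_1. unfold mid. simpl. ring.
  - simpl pred.
    pose proof (f_equal RtoC (weight_S n)) as E'. rewrite !RtoC_mult, RtoC_plus, RtoC_mult in E'.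
    rewrite <- E'.
    transitivity (weight (S n) * (J * (INR (S (S n)) * MP lambda phi x (S (S n)) + (2 * lambda + INR n) * MP lambda phi x n - mid (S n) * MP lambda phi x (S n))
      - (INR (S (S n)) * MPassoc (S (S n)) + (2 * lambda + INR n) * MPassoc n - mid (S n) * MPassoc (S n)))); [ring|].
    rewrite MPassoc_rec, MP_rec. unfold mid. ring.
Qed.

Lemma b_gt0 : (0 < b)%R.
Proof. unfold b; lra. Qed.

Lemma Re_B : Re B = b.
Proof. unfold B, b. destruct x; simpl; ring. Qed.

Lemma Re_B1 : Re (B - 1) = (b - 1)%R.
Proof. unfold B, b. destruct x; simpl; ring. Qed.

Lemma moment_kernel_bound : exists D, (0 <= D)%R /\ forall n t, (0 <= t < 1)%R ->
  (Cmod (moment_kernel n t) <= D * (t ^ n * Rpower (1 - t) (b - 1)))%R.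
Proof.
  destruct (kernel_bound (B - 1) (A - 1)) as [D [HD H]]. exists D; split; [exact HD|].
  intros n t Ht. unfold moment_kernel. rewrite Cmod_mult, Cmod_a, Rmult_1_l, <- Re_B1.
  apply H, Ht.
Qed.

Lemma moment_bound : exists D, (0 <= D)%R /\ forall n T, (0 <= T < 1)%R ->
  (Cmod (moment n T) <= D * beta_bound b n)%R.
Proof.
  destruct moment_kernel_bound as [D [HD H]]. exists (2 * D)%R; split; [lra|].
  intros n T HT.
  pose proof (RInt_correct (V := R_CompleteNormedModule) _ _ _ (ex_RInt_beta b n T HT)) as I.
  apply (is_RInt_scal (V := R_NormedModule) _ _ _ D) in I.
  eapply Rle_trans.
  - apply Cmod_cint_le with (g := fun t => (D * (t ^ n * Rpower (1 - t) (b - 1)))%R); [lra| | |].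
    + intros t Ht; apply moment_cdiff; lra.
    + eexists; exact I.
    + intros t Ht; apply H; lra.
  - assert (E : RInt (fun t => (D * (t ^ n * Rpower (1 - t) (b - 1)))%R) 0 T = (D * beta_int b n T)%R)
      by exact (is_RInt_unique (V := R_CompleteNormedModule) _ _ _ _ I).
    rewrite E, Rmult_assoc. apply Rmult_le_compat_l; [lra|].
    apply Rmult_le_compat_l; [exact HD|]. apply beta_int_le; [apply b_gt0|exact HT].
Qed.

Lemma moment0_limit : exists J : C, exists D, (0 <= D)%R /\
  forall T, (0 <= T < 1)%R -> (Cmod (J - moment 0 T) <= D * Rpower (1 - T) b)%R.
Proof.
  destruct moment_kernel_bound as [D [HD H]].
  assert (W : forall f : C -> R, (forall z, (Rabs (f z) <= Cmod z)%R) ->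
    (forall t, (0 <= t < 1)%R -> continuous (fun s => f (moment_kernel 0 s)) t) ->
    exists j, forall T, (0 <= T < 1)%R ->
      (Rabs (j - RInt (fun s => f (moment_kernel 0 s)) 0 T) <= D / b * Rpower (1 - T) b)%R).
  { intros f Hf Hc. apply improper_limit; [apply b_gt0|exact Hc|].
    intros t Ht. eapply Rle_trans; [apply Hf|].
    eapply Rle_trans; [apply H, Ht|]. simpl. rewrite Rmult_1_l. apply Rle_refl. }
  destruct (W Re) as [j1 H1].
  { intro z; eapply Rle_trans; [|apply Rmax_Cmod]; apply Rmax_l. }
  { intros t Ht. destruct (moment_cdiff 0 t) as [l Hl]; [lra|]. apply (cderive_continuous _ _ _ Hl). }
  destruct (W Im) as [j2 H2].
  { intro z; eapply Rle_trans; [|apply Rmax_Cmod]; apply Rmax_r. }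
  { intros t Ht. destruct (moment_cdiff 0 t) as [l Hl]; [lra|]. apply (cderive_continuous _ _ _ Hl). }
  exists (j1, j2), (2 * (D / b))%R. split.
  { apply Rmult_le_pos; [lra|]. apply Rmult_le_pos; [exact HD|apply Rlt_le, Rinv_0_lt_compat, b_gt0]. }
  intros T HT. specialize (H1 T HT); specialize (H2 T HT).
  unfold moment, cint.
  set (r1 := RInt _ 0 T) in *. set (r2 := RInt (fun s => Im (moment_kernel 0 s)) 0 T) in *.
  replace ((j1, j2) - (r1, r2)) with (RtoC (j1 - r1) + Ci * RtoC (j2 - r2)).
  2:{ unfold Cminus, Copp, Cplus, Cmult, Ci, RtoC; simpl; f_equal; ring. }
  eapply Rle_trans; [apply Cmod_triangle|]. rewrite Cmod_mult, Cmod_Ci, !Cmod_R. lra.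
Qed.

(** The difference obeys the common recurrence with source [kernel n B A T], which is O((1-T)^b),
    and starts at O((1-T)^b). Thus w_n y_n = g_n follows from convergence at n = 0 alone. *)
Lemma second_kind_moment (J : C) (D0 : R) : (0 <= D0)%R ->
  (forall T, (0 <= T < 1)%R -> (Cmod (J - moment 0 T) <= D0 * Rpower (1 - T) b)%R) ->
  forall n, exists D, (0 <= D)%R /\ forall T, (0 <= T < 1)%R ->
    (Cmod (weight n * second_kind J n - moment n T) <= D * Rpower (1 - T) b)%R.
Proof.
  intros HD0 HJ.
  destruct (kernel_bound B A) as [D1 [HD1 HK]]. rewrite Re_B in HK.
  set (e := fun n T => weight n * second_kind J n - moment n T).
  assert (erec : forall n T, (0 <= T < 1)%R ->
    (INR n + 2 * lambda) * e (S n) T = mid n * e n T - INR n * e (pred n) T - kernel n B A T).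
  { intros n T HT. pose proof (second_kind_rec J n) as E1. pose proof (moment_rec n T HT) as E2.
    unfold e.
    transitivity ((INR n * (weight (pred n) * second_kind J (pred n)) + - mid n * (weight n * second_kind J n)
      + (INR n + 2 * lambda) * (weight (S n) * second_kind J (S n)))
      - (INR n * moment (pred n) T + - mid n * moment n T + (INR n + 2 * lambda) * moment (S n) T)
      + mid n * (weight n * second_kind J n - moment n T)
      - INR n * (weight (pred n) * second_kind J (pred n) - moment (pred n) T)); [ring|].
    rewrite E1, E2. ring. }
  (* The recurrence has three terms, so two consecutive bounds are carried; at n = 0 they coincide
     because [pred 0] is 0. *)
  assert (H : forall n,
    (exists D, (0 <= D)%R /\ forall T, (0 <= T < 1)%R -> (Cmod (e (pred n) T) <= D * Rpower (1 - T) b)%R) /\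
    (exists D, (0 <= D)%R /\ forall T, (0 <= T < 1)%R -> (Cmod (e n T) <= D * Rpower (1 - T) b)%R)).
  { induction n as [|n [[Dp [HDp Hp]] [D [HD Hn]]]].
    - assert (H0 : exists D, (0 <= D)%R /\ forall T, (0 <= T < 1)%R -> (Cmod (e 0%nat T) <= D * Rpower (1 - T) b)%R).
      { exists D0. split; [exact HD0|]. intros T HT. unfold e, second_kind.
        rewrite MP_0, MPassoc_0. simpl weight.
        replace (1 * (J * 1 - 0) - moment 0 T) with (J - moment 0 T) by ring. apply HJ, HT. }
      split; exact H0.
    - split; [exists D; split; [exact HD|exact Hn]|].
      pose proof (pos_INR n) as Hn0.
      assert (Hc : (0 < INR n + 2 * lambda)%R) by lra.
      exists ((Cmod (mid n) * D + INR n * Dp + D1) / (INR n + 2 * lambda))%R.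
      pose proof (Cmod_ge_0 (mid n)).
      split.
      { apply Rmult_le_pos; [|apply Rlt_le, Rinv_0_lt_compat, Hc].
        repeat apply Rplus_le_le_0_compat; try apply Rmult_le_pos; assumption. }
      intros T HT. specialize (Hp T HT). specialize (Hn T HT).
      pose proof (f_equal Cmod (erec n T HT)) as E.
      rewrite Cmod_mult, <- RtoC_mult, <- RtoC_plus, Cmod_R, Rabs_right in E by lra.
      pose proof (Rpower_ge0 (1 - T) b) as HR. set (R := Rpower (1 - T) b) in *.
      apply Rmult_le_reg_l with (INR n + 2 * lambda)%R; [exact Hc|].
      match goal with |- (_ <= ?r)%R =>
        replace r with (Cmod (mid n) * (D * R) + INR n * (Dp * R) + D1 * R)%R by (field; lra) end.
      rewrite E. unfold Cminus.
      eapply Rle_trans; [apply Cmod_triangle|]. apply Rplus_le_compat.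
      + eapply Rle_trans; [apply Cmod_triangle|].
        rewrite Cmod_opp, !Cmod_mult, Cmod_R, (Rabs_right (INR n)) by lra.
        apply Rplus_le_compat; apply Rmult_le_compat_l; assumption.
      + rewrite Cmod_opp. eapply Rle_trans; [apply HK, HT|].
        apply Rmult_le_compat_l; [exact HD1|]. fold R.
        rewrite <- (Rmult_1_l R) at 2. apply Rmult_le_compat_r; [exact HR|].
        rewrite <- (pow1 n). apply pow_incr; lra. }
  intro n. exact (proj2 (H n)).
Qed.

(** Let T tend to 1 for each n: the bound on the moments is uniform in n and T, while the
    n-dependent error constant disappears. *)
Lemma Cmod_weighted_second_kind_le (J : C) (D0 : R) : (0 <= D0)%R ->
  (forall T, (0 <= T < 1)%R -> (Cmod (J - moment 0 T) <= D0 * Rpower (1 - T) b)%R) ->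
  exists D, (0 <= D)%R /\
  forall n, (weight n * Cmod (second_kind J n) <= D * beta_bound b n)%R.
Proof.
  intros HD0 HJ. destruct moment_bound as [D [HD H]]. exists D; split; [exact HD|]. intro n.
  destruct (second_kind_moment J D0 HD0 HJ n) as [E [HE Hn]].
  apply le_epsilon. intros e He.
  destruct (Rpower_compl_small b (e / (E + 1)) b_gt0) as [T [HT Hsmall]].
  { apply Rdiv_lt_0_compat; lra. }
  specialize (Hsmall T ltac:(lra)). specialize (Hn T HT). specialize (H n T HT).
  replace (weight n * Cmod (second_kind J n))%R with (Cmod (weight n * second_kind J n)).
  2:{ rewrite Cmod_mult, Cmod_R, Rabs_right; [reflexivity|]. pose proof (weight_gt0 n); lra. }
  replace (weight n * second_kind J n)
    with (moment n T + (weight n * second_kind J n - moment n T)) by ring.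
  eapply Rle_trans; [apply Cmod_triangle|]. apply Rplus_le_compat; [exact H|].
  eapply Rle_trans; [exact Hn|].
  apply Rle_trans with ((E + 1) * (e / (E + 1)))%R.
  - apply Rmult_le_compat; try lra. apply Rpower_ge0.
  - right; field; lra.
Qed.

(** * Size of the second-kind solution against the weights *)

Lemma beta_bound_gt0 (n : nat) : (0 < beta_bound b n)%R.
Proof.
  induction n as [|n IH]; [apply Rinv_0_lt_compat, b_gt0|].
  change (beta_bound b (S n)) with (beta_bound b n * (INR (S n) / (INR (S n) + b)))%R.
  apply Rmult_lt_0_compat; [exact IH|].
  assert (0 < INR (S n))%R by (apply lt_0_INR; lia). pose proof b_gt0.
  apply Rdiv_lt_0_compat; lra.
Qed.

Lemma beta_bound_S_le (n : nat) : (beta_bound b (S n) <= beta_bound b n)%R.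
Proof.
  pose proof (beta_bound_gt0 n). pose proof b_gt0. pose proof (pos_INR (S n)).
  change (beta_bound b (S n)) with (beta_bound b n * (INR (S n) / (INR (S n) + b)))%R.
  rewrite <- (Rmult_1_r (beta_bound b n)) at 2.
  apply Rmult_le_compat_l; [lra|].
  apply Rmult_le_reg_r with (INR (S n) + b)%R; [lra|].
  unfold Rdiv. rewrite Rmult_assoc, Rinv_l; lra.
Qed.

(** The two sides have orders n^(1-2b) and n^(1-2 lambda). The inductive step reduces to m (m + 2
    lambda) <= (m + b)^2, which holds since b >= lambda; the constant gives equality at n = 0. *)
Lemma beta_bound_weight_le (n : nat) :
  (INR (S n) * beta_bound b n ^ 2 <= beta_bound b 0 ^ 2 / weight 1 * weight (S n))%R.
Proof.
  induction n as [|n IH].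
  - right. pose proof (weight_gt0 1). simpl INR. field. lra.
  - pose proof (weight_gt0 (S n)) as W. pose proof b_gt0 as Hb.
    pose proof (pos_INR (S n)) as Hn. pose proof (weight_S (S n)) as WS.
    change (beta_bound b (S n)) with (beta_bound b n * (INR (S n) / (INR (S n) + b)))%R.
    set (k := (beta_bound b 0 ^ 2 / weight 1)%R) in *. set (m := INR (S n)) in *.
    set (m' := INR (S (S n))) in *. set (v := beta_bound b n) in *.
    assert (Hm' : (0 < m')%R) by (apply lt_0_INR; lia).
    assert (Hk : (0 <= k * weight (S n))%R).
    { eapply Rle_trans; [|exact IH]. apply Rmult_le_pos; [exact Hn|apply pow2_ge_0]. }
    assert (E : (weight (S (S n)) = m' * weight (S n) / (m + 2 * lambda))%R).
    { rewrite <- WS. field. lra. }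
    rewrite E.
    apply Rle_trans with (m' * (m / (m + b) ^ 2) * (k * weight (S n)))%R.
    + replace (m' * (v * (m / (m + b))) ^ 2)%R with (m' * (m / (m + b) ^ 2) * (m * v ^ 2))%R
        by (field; lra).
      apply Rmult_le_compat_l; [|exact IH].
      apply Rmult_le_pos; [lra|]. apply Rmult_le_pos; [exact Hn|].
      apply Rlt_le, Rinv_0_lt_compat, pow_lt; lra.
    + replace (k * (m' * weight (S n) / (m + 2 * lambda)))%R
        with (m' * / (m + 2 * lambda) * (k * weight (S n)))%R by (field; lra).
      apply Rmult_le_compat_r; [exact Hk|]. apply Rmult_le_compat_l; [lra|].
      apply Rmult_le_reg_r with ((m + b) ^ 2 * (m + 2 * lambda))%R.
      { apply Rmult_lt_0_compat; [apply pow_lt|]; lra. }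
      replace (m / (m + b) ^ 2 * ((m + b) ^ 2 * (m + 2 * lambda)))%R with (m * (m + 2 * lambda))%R
        by (field; lra).
      replace (/ (m + 2 * lambda) * ((m + b) ^ 2 * (m + 2 * lambda)))%R with ((m + b) ^ 2)%R
        by (field; lra).
      unfold b in *. nra.
Qed.

(** By [weight_S] this is also (n + 2 lambda) w_{n+1}; the agreement of the two forms is the
    symmetry of the weighted recurrence. *)
Definition offdiag (n : nat) : R := (INR (S n) * weight n)%R.

Lemma second_kind_product_bounded (J : C) (D : R) : (0 <= D)%R ->
  (forall n, (weight n * Cmod (second_kind J n) <= D * beta_bound b n)%R) ->
  forall n, (offdiag n * (Cmod (second_kind J (S n)) * Cmod (second_kind J n))
             <= D ^ 2 * (beta_bound b 0 ^ 2 / weight 1))%R.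
Proof.
  intros HD H n. unfold offdiag.
  pose proof (weight_gt0 (S n)) as W. pose proof (weight_gt0 n) as W0.
  pose proof (H n) as H0. pose proof (H (S n)) as H1.
  pose proof (Cmod_ge_0 (second_kind J n)) as P0.
  pose proof (Cmod_ge_0 (second_kind J (S n))) as P1.
  set (u := Cmod (second_kind J n)) in *. set (v := Cmod (second_kind J (S n))) in *.
  pose proof (beta_bound_gt0 n) as B0. pose proof (beta_bound_S_le n) as B1.
  pose proof (beta_bound_weight_le n) as L. pose proof (pos_INR (S n)) as Hn.
  assert (H1' : (weight (S n) * v <= D * beta_bound b n)%R).
  { eapply Rle_trans; [exact H1|]. apply Rmult_le_compat_l; assumption. }
  (* The extra factor supplies the weight missing from the modulus at n + 1, so that both moduli can
     be bounded by [beta_bound b n]. *)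
  apply Rmult_le_reg_l with (weight (S n)); [exact W|].
  apply Rle_trans with (INR (S n) * ((D * beta_bound b n) * (D * beta_bound b n)))%R.
  - replace (weight (S n) * (INR (S n) * weight n * (v * u)))%R
      with (INR (S n) * ((weight (S n) * v) * (weight n * u)))%R by ring.
    apply Rmult_le_compat_l; [exact Hn|].
    apply Rmult_le_compat; try assumption; apply Rmult_le_pos; lra.
  - replace (INR (S n) * (D * beta_bound b n * (D * beta_bound b n)))%R
      with (D ^ 2 * (INR (S n) * beta_bound b n ^ 2))%R by ring.
    replace (weight (S n) * (D ^ 2 * (beta_bound b 0 ^ 2 / weight 1)))%R
      with (D ^ 2 * (beta_bound b 0 ^ 2 / weight 1 * weight (S n)))%R by ring.
    apply Rmult_le_compat_l; [apply pow2_ge_0|exact L].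
Qed.

Lemma recurrence_jacobi (u : nat -> C) :
  (forall n, INR (S (S n)) * u (S (S n)) + (2 * lambda + INR n) * u n = mid (S n) * u (S n)) ->
  forall n, jacobi offdiag weight (fun k => 2 * (INR k + lambda) * cos phi)%R
              (2 * (x * sin phi)) u n.
Proof.
  intros H n. unfold jacobi, offdiag.
  pose proof (f_equal RtoC (weight_S n)) as E. rewrite !RtoC_mult, RtoC_plus, RtoC_mult in E.
  rewrite !RtoC_mult, <- E, RtoC_plus.
  transitivity (weight (S n) * (INR (S (S n)) * u (S (S n)) + (2 * lambda + INR n) * u n)); [ring|].
  rewrite H. unfold mid. ring.
Qed.

(** * Identification of J with the improper segment integral *)

Lemma moment0_is_RInt (T : R) : (0 <= T < 1)%R ->
  is_RInt (V := C_R_NormedModule)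
    (fun t : R => (Cpower (1 - (0 + t * (a - 0)) * Cexp (Ci * phi)) (lambda - Ci * x - 1)
         * Cpower (1 - (0 + t * (a - 0)) * a) (lambda + Ci * x - 1)) * (a - 0)) 0 T (moment 0 T).
Proof.
  intro HT.
  apply is_RInt_ext with (f := moment_kernel 0).
  - intros t _. unfold moment_kernel, kernel.
    replace (1 - (0 + t * (a - 0)) * Cexp (Ci * phi)) with (1 - t * (a * Cexp (Ci * phi))) by ring.
    rewrite a_conj.
    replace (1 - (0 + t * (a - 0)) * a) with (1 - t * om) by (unfold om; ring).
    fold B A. simpl Cpow.
    change (a * (1 * (Cpower (1 - t * 1) (B - 1) * Cpower (1 - t * om) (A - 1)))
      = Cpower (1 - t * 1) (B - 1) * Cpower (1 - t * om) (A - 1) * (a - 0)). ring.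
  - destruct (cdiff_integrable (moment_kernel 0) 0 T) as [E1 E2]; [lra| |].
    { intros t Ht; apply moment_cdiff; lra. }
    apply (is_RInt_fct_extend_pair (U := R_NormedModule) (V := R_NormedModule));
      apply (RInt_correct (V := R_CompleteNormedModule)); assumption.
Qed.

Lemma segment_integral_moment0 (J : C) (D : R) : (0 <= D)%R ->
  (forall T, (0 <= T < 1)%R -> (Cmod (J - moment 0 T) <= D * Rpower (1 - T) b)%R) ->
  is_segment_integral
    (fun u : C => Cpower (1 - u * Cexp (Ci * phi)) (lambda - Ci * x - 1)
         * Cpower (1 - u * Cexp (- (Ci * phi))) (lambda + Ci * x - 1))
    0 (Cexp (- (Ci * phi))) J.
Proof.
  intros HD HJ P [eps HP]. pose proof (cond_pos eps) as Heps.
  (* The 2 makes the final inequality strict, and D + 1 avoids dividing by zero when D = 0. *)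
  destruct (Rpower_compl_small b (eps / (2 * (D + 1))) b_gt0) as [T0 [HT0 Hs]].
  { apply Rdiv_lt_0_compat; lra. }
  unfold filtermapi.
  apply Filter_prod with (Q := fun s => s = 0%R) (R := fun T => (T0 <= T < 1)%R).
  - reflexivity.
  - assert (H1 : (0 < 1 - T0)%R) by lra.
    exists (mkposreal _ H1). intros T HB HT.
    apply Rabs_lt_between in HB. unfold minus, plus, opp in HB; simpl in HB. lra.
  - intros s T -> HT. simpl fst; simpl snd.
    exists (moment 0 T). split; [apply moment0_is_RInt; lra|].
    apply HP.
    assert (L : (Cmod (moment 0 T - J) < eps)%R).
    { replace (moment 0 T - J) with (- (J - moment 0 T)) by ring. rewrite Cmod_opp.
      eapply Rle_lt_trans; [apply HJ; lra|].
      apply Rle_lt_trans with ((D + 1) * (eps / (2 * (D + 1))))%R.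
      - apply Rmult_le_compat; try lra; [apply Rpower_ge0|apply Hs, HT].
      - replace ((D + 1) * (eps / (2 * (D + 1))))%R with (eps / 2)%R by (field; lra). lra. }
    (* Balls in [C] are product balls here, so each component is tested. *)
    split.
    + eapply Rle_lt_trans; [|exact L]. eapply Rle_trans; [|apply Rmax_Cmod]. apply Rmax_l.
    + eapply Rle_lt_trans; [|exact L]. eapply Rle_trans; [|apply Rmax_Cmod]. apply Rmax_r.
Qed.
End Kernel.

Theorem mainTheorem8 (lambda phi : R) (x : C)
  (hlambda : (0 < lambda)%R) (hphi0 : (0 < phi)%R) (hphiPI : (phi < PI)%R)
  (hx : (0 < Im x)%R) :
  eventually (fun n : nat => MP lambda phi x n <> 0) /\
  exists J : C,
    is_segment_integral
      (fun u : C =>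
         Cpower (1 - u * Cexp (Ci * phi)) (lambda - Ci * x - 1)
         * Cpower (1 - u * Cexp (- (Ci * phi))) (lambda + Ci * x - 1))
      0 (Cexp (- (Ci * phi))) J /\
    filterlim (fun n : nat => MPnum lambda phi x n / MP lambda phi x n)
      eventually (locally (2 * sin phi * J)).
Proof.
  pose proof (sin_phi_gt0 phi hphi0 hphiPI) as Hs.
  destruct (moment0_limit lambda phi x hlambda hphi0 hphiPI hx) as [J [D0 [HD0 HJ]]].
  destruct (Cmod_weighted_second_kind_le lambda phi x hlambda hphi0 hphiPI hx J D0 HD0 HJ)
    as [D [HD HDy]].
  pose proof (second_kind_product_bounded lambda phi x hlambda hx J D HD HDy) as HK.
  pose proof (fun n => weight_gt0 lambda hlambda n) as Hw.
  assert (Hc : forall n, (0 < offdiag lambda n)%R).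
  { intro n. apply Rmult_lt_0_compat; [apply lt_0_INR; lia|apply Hw]. }
  (* Using both forms of [offdiag], c_n^2 = (n+1)(n + 2 lambda) w_n w_{n+1}; M = 1 + 2 lambda
     dominates both shifts. *)
  assert (Hcle : forall n, (offdiag lambda n ^ 2
     <= (INR n + (1 + 2 * lambda)) ^ 2 * (weight lambda n * weight lambda (S n)))%R).
  { intro n. pose proof (weight_S lambda hlambda n) as E. unfold offdiag.
    pose proof (Hw n); pose proof (Hw (S n)). pose proof (pos_INR n).
    replace ((INR (S n) * weight lambda n) ^ 2)%R
      with (INR (S n) * weight lambda n * (INR (S n) * weight lambda n))%R by ring.
    rewrite <- E at 2.
    replace (INR (S n) * weight lambda n * ((INR n + 2 * lambda) * weight lambda (S n)))%R
      with (INR (S n) * (INR n + 2 * lambda) * (weight lambda n * weight lambda (S n)))%R by ring.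
    apply Rmult_le_compat_r; [apply Rmult_le_pos; lra|]. rewrite S_INR. nra. }
  assert (Hz : (0 < Im (2 * (x * sin phi)))%R).
  { replace (Im (2 * (x * sin phi))) with (2 * (Im x * sin phi))%R by (destruct x; simpl; ring).
    pose proof (Rmult_lt_0_compat _ _ hx Hs). lra. }
  assert (HM : (0 < 1 + 2 * lambda)%R) by lra.
  pose proof (recurrence_jacobi lambda phi x hlambda _ (MP_rec lambda phi x)) as Hp.
  pose proof (recurrence_jacobi lambda phi x hlambda _
                (MPassoc_rec lambda phi x hphi0 hphiPI)) as Hq.
  pose proof (MP_0 lambda phi x) as Hp0. pose proof (MPassoc_0 lambda phi x) as Hq0.
  assert (Hp1 : offdiag lambda 0 * MP lambda phi x 1
     = (2 * (x * sin phi) + (2 * (INR 0 + lambda) * cos phi)%R) * weight lambda 0).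
  { rewrite MP_1. unfold offdiag. simpl. rewrite !RtoC_mult, RtoC_plus. ring. }
  assert (Hq1 : offdiag lambda 0 * MPassoc lambda phi x 1 = 1).
  { rewrite (MPassoc_1 lambda phi x hphi0 hphiPI). unfold offdiag. simpl. rewrite RtoC_mult. ring. }
  pose proof (jacobi_neq0 (offdiag lambda) (weight lambda)
    (fun k => 2 * (INR k + lambda) * cos phi)%R (2 * (x * sin phi)) (MP lambda phi x)) as Hne.
  pose proof (jacobi_limit_point (offdiag lambda) (weight lambda)
    (fun k => 2 * (INR k + lambda) * cos phi)%R (2 * (x * sin phi)) (MP lambda phi x)
    (MPassoc lambda phi x) J (1 + 2 * lambda)) as HL.
  specialize (Hne Hw Hz Hp Hp0 Hp1).
  split; [exists O; intros n _; apply Hne|].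
  exists J. split.
  - apply (segment_integral_moment0 lambda phi x hlambda hphi0 hphiPI hx J D0 HD0 HJ).
  - specialize (HL _ Hw Hc Hcle HM Hz Hp Hq Hp0 Hq0 Hp1 Hq1 HK).
    apply filterlim_ext with (f := fun n => 2 * sin phi * (MPassoc lambda phi x n / MP lambda phi x n)).
    + intro n. unfold MPassoc. field. split; [apply Hne|apply RtoC_neq0; lra].
    + apply (filterlim_comp _ _ _ _ (fun u : C => 2 * sin phi * u) _ _ _ HL).
      apply (filterlim_scal_r (K := C_AbsRing) (V := C_NormedModule) (2 * sin phi) J).
Qed.
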